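(* Let \(F_o\in\mathcal M\) be such that \((F_o,W)\) is split over \(\mathbb R\), and suppose that \(\beta:(a,\infty)\to\mathfrak h\) is a differentiable function satisfying the Lax equation \[\frac{d\beta}{dy}=-[\beta(y),L\beta(y)].\] Then there exist a function \(h:(a,\infty)\to H\), an element \(\tilde N\in\mathfrak h\) and a point \(\tilde F\in\check{\mathcal M}\) such that (a) \(h^{-1}(y)\frac{dh}{dy}=-L\beta(y)\) and \(\beta(y)=\mathrm{Ad}(h^{-1}(y))\tilde N\); (b) \(h(y).F_o=e^{iy\tilde N}.\tilde F\).
   Context: \(V_{\mathbb Q}\) finite-dimensional over \(\mathbb Q\), \(V=V_{\mathbb Q}\otimes\mathbb C\), \(W\) an increasing rational filtration, \(Q=\{Q_k\}\) nondegenerate rational bilinear forms on \(Gr^W_k\) of parity \((-1)^k\); \(\mathcal M\) the set of decreasing filtrations (fixed \(\dim F^p\)) with \((F,W)\) a mixed Hodge structure graded-polarized by \(Q\). \(G=\{g\in GL(V):g\text{ preserves }W,\ Gr(g)\text{ real automorphism of }Q\}\); \(G_{\mathbb C}\) analogous with complex automorphisms, \(\mathfrak g_{\mathbb C}=\mathrm{Lie}(G_{\mathbb C})\), \(\check{\mathcal M}\) the \(G_{\mathbb C}\)-orbit of \(\mathcal M\). \(H=\{g\in G: g\text{ induces real automorphisms of }W_k/W_{k-2}\ \forall k\}\), \(\mathfrak h=\mathrm{Lie}(H)\). Deligne bigrading of \((F_o,W)\): unique \(V=\bigoplus I^{p,q}\) with \(F_o^p=\bigoplus_{a\ge p}I^{a,b}\),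 \(W_k=\bigoplus_{a+b\le k}I^{a,b}\), \(\overline{I^{p,q}}\equiv I^{q,p}\bmod\bigoplus_{r<q,s<p}I^{r,s}\) (split over \(\mathbb R\): equality). \(\mathfrak g^{r,s}_{\mathbb C}\) = elements of \(\mathfrak g_{\mathbb C}\) mapping \(I^{p,q}\) into \(I^{p+r,q+s}\); \(\eta_+=\bigoplus_{r\ge0,s<0}\mathfrak g^{r,s}_{\mathbb C}\), \(\eta_0=\mathfrak g^{0,0}_{\mathbb C}\), \(\eta_-=\bigoplus_{r<0,s\ge0}\mathfrak g^{r,s}_{\mathbb C}\), \(\Lambda=\bigoplus_{r,s<0}\mathfrak g^{r,s}_{\mathbb C}\), so \(\mathfrak g_{\mathbb C}=\eta_+\oplus\eta_0\oplus\eta_-\oplus\Lambda\). \(L\) is the endomorphism acting as \(+i\) on \(\eta_+\), \(0\) on \(\eta_0\), \(-i\) on \(\eta_-\oplus\Lambda\); it restricts to an endomorphism of \(\mathfrak h\). *)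

(* Defs.v *)
(* Complex numbers are R[i] := complex R
   (mathcomp-real-closed) over an arbitrary R : realType. *)
From HB Require Import structures.
From mathcomp Require Import all_boot all_order all_algebra.
From mathcomp Require Import all_classical all_reals all_analysis.
From mathcomp Require Import complex.
Set Implicit Arguments. Unset Strict Implicit. Unset Printing Implicit Defensive.
Import Order.TTheory GRing.Theory Num.Theory numFieldNormedType.Exports.
Local Open Scope ring_scope.

(* Conventions.  V = C^n (C = R[i]) with its standard rational structure      *)
(* V_Q = Q^n.  Vectors are row vectors 'rV_n, subspaces are row spaces of     *)
(* n x n matrices (mxalgebra).  A linear endomorphism g of V is represented   *)
(* by its matrix in the standard basis acting on coordinate columns, i.e.     *)
(* g(v) = v *m g^T on rows; thus composition of maps = matrix product, and    *)
(* the paper's formulas h^{-1} dh/dy, Ad(h^{-1})N = h^{-1} N h are literal.   *)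

Section HodgeDefs.
Variable R : realType.
Local Notation C := R[i].
Variable n : nat.

(* apply the endomorphism g to a vector, image of a subspace under g *)
Definition app (g : 'M[C]_n) (v : 'rV[C]_n) : 'rV[C]_n := v *m g^T.
Definition img (g : 'M[C]_n) (U : 'M[C]_n) : 'M[C]_n := U *m g^T.

(* complex conjugation (w.r.t. the real structure V_R = R^n) *)
Definition conjm m p (A : 'M[C]_(m, p)) : 'M[C]_(m, p) := map_mx (fun z => z^*) A.

(* rationality w.r.t. V_Q = Q^n *)
Definition rational_mx m p (A : 'M[C]_(m, p)) : Prop :=
  exists A0 : 'M[rat]_(m, p), A = map_mx ratr A0.
Definition rational_subspace (U : 'M[C]_n) : Prop :=
  exists A0 : 'M[rat]_n, (U == map_mx ratr A0)%MS.

(* increasing (finite, exhaustive, separated) rational filtration W *)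
Definition rational_increasing_filtration (W : int -> 'M[C]_n) : Prop :=
  [/\ forall k, (W k <= W (k + 1)%R)%MS,
      exists k0 k1 : int, (forall k, k <= k0 -> (W k == (0 : 'M[C]_n))%MS) /\
                          (forall k, k1 <= k -> (W k == 1%:M)%MS)
    & forall k, rational_subspace (W k)].

(* decreasing (finite) filtration F *)
Definition decreasing_filtration (F : int -> 'M[C]_n) : Prop :=
  (forall p, (F (p + 1)%R <= F p)%MS) /\
  exists p0 p1 : int, (forall p, p <= p0 -> (F p == 1%:M)%MS) /\
                      (forall p, p1 <= p -> (F p == (0 : 'M[C]_n))%MS).

(* bilinear form with matrix B : (x, y) |-> x B y^T *)
Definition bil (B : 'M[C]_n) (x y : 'rV[C]_n) : C := (x *m B *m y^T) 0 0.

(* Q = {Q_k}: Q_k is a bilinear form on Gr^W_k = W_k / W_{k-1}, represented  *)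
(* by a rational form (Q k) on V whose restriction to W_k has radical         *)
(* exactly W_{k-1} (= a nondegenerate form on Gr^W_k); parity (-1)^k.        *)
Definition graded_forms (W : int -> 'M[C]_n) (Q : int -> 'M[C]_n) : Prop :=
  forall k : int,
  [/\ rational_mx (Q k),
      (Q k)^T = ((-1 : C) ^ k) *: Q k,
      (forall x y, (x <= W (k - 1)%R)%MS -> (y <= W k)%MS -> bil (Q k) x y = 0)
    & (forall x, (x <= W k)%MS ->
         (forall y, (y <= W k)%MS -> bil (Q k) x y = 0) -> (x <= W (k - 1)%R)%MS)].

(* the subspace of W_k which represents F^p Gr^W_k (it contains W_{k-1}) *)
Definition grF (W F : int -> 'M[C]_n) (k p : int) : 'M[C]_n :=
  (F p :&: W k + W (k - 1)%R)%MS.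

(* (F, W) is a mixed Hodge structure graded-polarized by Q: F is a finite    *)
(* decreasing filtration inducing on each Gr^W_k a pure Hodge structure of    *)
(* weight k, Gr^W_k = F^p (+) conj F^{k-p+1}, polarized by Q_k:               *)
(* Q_k(F^p, F^{k-p+1}) = 0 and i^{p-q} Q_k(v, conj v) > 0 for 0 != v in H^{p,q}. *)
Definition is_GPMHS (W Q F : int -> 'M[C]_n) : Prop :=
  decreasing_filtration F /\
  forall k p : int,
  [/\ (grF W F k p + conjm (grF W F k (k - p + 1)%R) == W k)%MS,
      (grF W F k p :&: conjm (grF W F k (k - p + 1)%R) == W (k - 1)%R)%MS,
      (forall x y, (x <= F p :&: W k)%MS -> (y <= F (k - p + 1)%R :&: W k)%MS ->
          bil (Q k) x y = 0)
    & (forall v, (v <= grF W F k p)%MS -> (v <= conjm (grF W F k (k - p)%R))%MS ->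
          ~~ (v <= W (k - 1)%R)%MS ->
          0 < 'i ^ (p - (k - p)%R) * bil (Q k) v (conjm v))].

(* the classifying space M (filtrations with prescribed dims d p = dim F^p) *)
Definition in_M (W Q : int -> 'M[C]_n) (d : int -> nat) (F : int -> 'M[C]_n) : Prop :=
  is_GPMHS W Q F /\ forall p, \rank (F p) = d p.

(* the groups G_C, G, H *)
Definition in_GC (W Q : int -> 'M[C]_n) (g : 'M[C]_n) : Prop :=
  [/\ g \in unitmx,
      forall k, (img g (W k) <= W k)%MS
    & forall k x y, (x <= W k)%MS -> (y <= W k)%MS ->
        bil (Q k) (app g x) (app g y) = bil (Q k) x y].

(* Gr(g) real : g commutes with conjugation modulo W_{k-1} on W_k *)
Definition in_G (W Q : int -> 'M[C]_n) (g : 'M[C]_n) : Prop :=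
  in_GC W Q g /\
  forall k x, (x <= W k)%MS ->
     ((conjm (app g x) - app g (conjm x))%R <= W (k - 1)%R)%MS.

(* H : g induces real automorphisms of W_k / W_{k-2} *)
Definition in_H (W Q : int -> 'M[C]_n) (g : 'M[C]_n) : Prop :=
  in_G W Q g /\
  forall k x, (x <= W k)%MS ->
     ((conjm (app g x) - app g (conjm x))%R <= W (k - 2)%R)%MS.

(* G_C-orbit of M *)
Definition in_Mcheck (W Q : int -> 'M[C]_n) (d : int -> nat) (F : int -> 'M[C]_n) : Prop :=
  exists g F', [/\ in_GC W Q g, in_M W Q d F' & forall p, (F p == img g (F' p))%MS].

(* matrix exponential, defined entrywise as the sum of the exponential series *)
Definition expm_partial (A : 'M[C]_n) (N : nat) : 'M[C]_n :=
  \sum_(k < N) ((k`!)%:R^-1 : C) *: A ^+ k.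
Definition expm (A : 'M[C]_n) : 'M[C]_n :=
  \matrix_(i, j) (limn (fun N => complex.Re (expm_partial A N i j)) +i*
                  limn (fun N => complex.Im (expm_partial A N i j)))%C.

(* Lie algebra of H : X with exp(tX) in H for all real t *)
Definition in_lieH (W Q : int -> 'M[C]_n) (X : 'M[C]_n) : Prop :=
  forall t : R, in_H W Q (expm ((t%:C)%C *: X)).

(* derivative of a matrix valued function of a real variable (entrywise) *)
Definition mx_derivable (f : R -> 'M[C]_n) (y : R) : Prop :=
  forall i j, derivable (fun t => complex.Re (f t i j)) y 1 /\
              derivable (fun t => complex.Im (f t i j)) y 1.
Definition mx_deriv (f : R -> 'M[C]_n) (y : R) : 'M[C]_n :=
  \matrix_(i, j) ('D_1 (fun t => complex.Re (f t i j)) y +i* 'D_1 (fun t => complex.Im (f t i j)) y)%C.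

(* bigradings: I p q, supported in the box |p|,|q| <= N *)
Definition bidx (N : nat) (ij : 'I_(2 * N + 1) * 'I_(2 * N + 1)) : int * int :=
  ((ij.1 : nat)%:Z - N%:Z, (ij.2 : nat)%:Z - N%:Z).

(* the Deligne bigrading of (F, W), split over R (exact conjugation symmetry) *)
Definition is_split_Deligne_bigrading (F W : int -> 'M[C]_n) (N : nat)
    (I : int -> int -> 'M[C]_n) : Prop :=
  [/\ (forall p q : int, (N%:Z < `|p| \/ N%:Z < `|q|) -> (I p q == (0 : 'M[C]_n))%MS),
      (* V = direct sum of the I^{p,q} *)
      (mxdirect (\sum_(ij : 'I_(2 * N + 1) * 'I_(2 * N + 1)) I (bidx ij).1 (bidx ij).2)
       /\ ((\sum_(ij : 'I_(2 * N + 1) * 'I_(2 * N + 1)) I (bidx ij).1 (bidx ij).2)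
             == 1%:M)%MS),
      (* F^p = sum_{a >= p} I^{a,b} *)
      (forall p, (F p == (\sum_(ij : 'I_(2 * N + 1) * 'I_(2 * N + 1) | (p <= (bidx ij).1)%R)
                            I (bidx ij).1 (bidx ij).2))%MS),
      (* W_k = sum_{a + b <= k} I^{a,b} *)
      (forall k, (W k == (\sum_(ij : 'I_(2 * N + 1) * 'I_(2 * N + 1)
                                | ((bidx ij).1 + (bidx ij).2 <= k)%R)
                            I (bidx ij).1 (bidx ij).2))%MS)
    & (* split over R: conj I^{p,q} = I^{q,p} *)
      (forall p q, (conjm (I p q) == I q p)%MS)].

(* the projection V -> I^{p,q} along the other I^{a,b} (as an endomorphism) *)
Definition piI (N : nat) (I : int -> int -> 'M[C]_n) (ij : 'I_(2 * N + 1) * 'I_(2 * N + 1))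
  : 'M[C]_n :=
  (proj_mx (I (bidx ij).1 (bidx ij).2)
     (\sum_(kl | kl != ij) I (bidx kl).1 (bidx kl).2)%MS)^T.

(* L acts by i on eta_+ (r >= 0, s < 0), 0 on eta_0 (r = s = 0),
   -i on eta_- (+) Lambda (r < 0); the component of X of type (r,s) is
   sum_{p,q} pi_{p+r,q+s} X pi_{p,q}. *)
Definition Lcoef (r s : int) : C :=
  if (0 <= r) && (s < 0) then 'i else if r < 0 then - 'i else 0.

Definition Lop (N : nat) (I : int -> int -> 'M[C]_n) (X : 'M[C]_n) : 'M[C]_n :=
  \sum_(ij : 'I_(2 * N + 1) * 'I_(2 * N + 1))
   \sum_(kl : 'I_(2 * N + 1) * 'I_(2 * N + 1))
     Lcoef ((bidx kl).1 - (bidx ij).1) ((bidx kl).2 - (bidx ij).2) *: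
       (piI I kl *m X *m piI I ij).

End HodgeDefs.

(* Main.v *)
Require Import Defs.
From HB Require Import structures.
From mathcomp Require Import all_boot all_order all_algebra.
From mathcomp Require Import all_classical all_reals all_analysis.
From mathcomp Require Import complex.
From mathcomp Require Import ring lra zify.
Set Implicit Arguments. Unset Strict Implicit. Unset Printing Implicit Defensive.
Import Order.TTheory GRing.Theory Num.Theory numFieldNormedType.Exports.
Local Open Scope classical_set_scope.
Local Open Scope ring_scope.

(** Fix y0 = a + 1 and let h solve the linear equation h' = - h L(beta) with
    h(y0) = 1.  The Lax equation says exactly that h beta h^-1 is constant, so
    it equals N := beta(y0).  On the Deligne bigrading, a block computation
    shows that L preserves the infinitesimal conditions defining H (the forms
    Q_k pair I^{p,q} only with I^{q,p}, and conj(L_{s,r}) = L_{r,s} when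
    r + s is 0 or -1), so h stays in H.  Finally
    k(y) = e^{-i(y - y0)N} h(y) solves k' = - k (i beta + L beta), and
    i beta + L beta has no component lowering the first index; hence k(y)
    fixes F_o and one may take F~ = e^{-i y0 N} F_o.

    Every invariance statement is a uniqueness statement for a linear equation
    Z' = X Z + Z Y, which follows from existence alone: multiply Z on both
    sides by fundamental solutions.  Existence is the Peano-Baker series, of
    which the exponential series is the case of constant coefficients. *)

(** * Real calculus: primitives, limits of derivatives, weighted estimates *)

Section RealAnalysis.
Variable R : realType.
Implicit Types f g : R -> R.

(** The obstacle is the coefficient -i on Lambda: there both indices are negative, and conjugation
    exchanges them but turns -i into i, so L does not commute with conjugation. Types (r, s) in
    Lambda have r + s <= -2, hence L respects reality only modulo [W (k - 2)], which is exactly the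
    tolerance built into H. The same value -i on Lambda is what lets i beta + L beta preserve F_o.
    Since iN need not be in Lie(H), e^{-i y0 N} is only known to lie in G_C, and F~ is found in the
    G_C-orbit. No Lie group theory enters: h is solved for among all matrices and membership in H is
    recovered afterwards. An inclusion of subspaces becomes a matrix identity after multiplication
    by [cokermx], invariance of a form becomes an identity of Gram matrices, and the defect of each
    identity solves a linear equation with initial value zero. *)

Lemma is_derive1_continuous f (x d : R) :
  is_derive x 1 f d -> {for x, continuous f}.
Proof.
by move=> fx; apply/differentiable_continuous/derivable1_diffP; case: fx.
Qed.

Lemma is_derive_within f (df : R -> R) (a b : R) :
  (forall x, a <= x <= b -> is_derive x 1 f (df x)) ->
  {within `[a, b], continuous f}.
Proof.
move=> H; apply: continuous_in_subspaceT => x /set_mem /=.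
rewrite in_itv /= => xab; exact: is_derive1_continuous (H _ xab).
Qed.

(** Mean value theorem for g - s f with s = 1 and s = -1: the derivative is nonnegative in both
    cases. *)
Lemma norm_increment_le f g (df dg : R -> R) (a b : R) : a <= b ->
  (forall x, a <= x <= b -> is_derive x 1 f (df x)) ->
  (forall x, a <= x <= b -> is_derive x 1 g (dg x)) ->
  (forall x, a <= x <= b -> `|df x| <= dg x) ->
  `|f b - f a| <= g b - g a.
Proof.
move=> ab Hf Hg Hd.
have inW x : x \in `]a, b[%R -> a <= x <= b.
  by rewrite in_itv /= => /andP[/ltW -> /ltW ->].
have key (s : R) : `|s| = 1 -> s * (f b - f a) <= g b - g a.
  move=> s1.
  have Hs x : a <= x <= b -> is_derive x 1 (g - s *: f) (dg x - s *: df x).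
    by move=> xab; apply: is_deriveB; [exact: Hg|apply: is_deriveZ; exact: Hf].
  have [|c cab E] := MVT_segment ab (fun x h => Hs x (inW x h)).
    exact: is_derive_within Hs.
  have cab' : a <= c <= b by move: cab; rewrite in_itv.
  have : 0 <= (dg c - s *: df c) * (b - a).
    apply: mulr_ge0; last by rewrite subr_ge0.
    rewrite subr_ge0; apply: le_trans (Hd _ cab').
    by rewrite (le_trans (ler_norm _))// normrM s1 mul1r.
  by rewrite -E !fctE /= /GRing.scale /=; lra.
rewrite ler_norml; apply/andP; split.
  by have := key (-1); rewrite normrN normr1 => /(_ erefl); lra.
by have := key 1; rewrite normr1 => /(_ erefl); lra.
Qed.

Lemma is_derive0_cst f (a b : R) : a <= b ->
  (forall x, a <= x <= b -> is_derive x 1 f 0) -> f a = f b.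
Proof.
move=> ab Hf; apply/eqP; rewrite eq_sym -subr_eq0 -normr_le0.
have := @norm_increment_le f (cst 0) (cst 0) (cst 0) a b ab Hf.
rewrite [_ - cst 0 a]subrr => H; by apply: H => x _; rewrite normr0.
Qed.

(** The integral starts at [b], so the fundamental theorem gives the derivative only to the right of
    [b]; [primitive] glues two such half lines. *)
Lemma primitive_right f (b : R) : (forall x, {for x, continuous f}) ->
  exists F : R -> R, forall x, b < x -> is_derive x 1 F (f x).
Proof.
move=> cf.
pose F x := (\int[lebesgue_measure]_(t in [set` `[b, x]]) f t)%R.
suff HF x : b < x -> derivable F x 1 /\ derive1 F x = f x.
  exists F => x /HF[]; move: F {HF} => F d e.
  by apply: (DeriveDef d); rewrite -derive1E.
move=> bx; apply: (@continuous_FTC1_closed R f b x (x + 1) _ _ bx (cf x)).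
- by rewrite ltrDl.
- apply: continuous_compact_integrable; first exact: segment_compact.
  exact: continuous_subspaceT cf.
Qed.

Lemma is_derive_flip f (x d : R) :
  is_derive (- x) 1 f d -> is_derive x 1 (fun t => f (- t)) (- d).
Proof.
move=> fx; have -> : (fun t => f (- t)) = f \o -%R by [].
by have := is_derive1_comp fx (is_deriveNid x 1); rewrite mulrN1.
Qed.

Lemma primitive f : (forall x, {for x, continuous f}) ->
  exists F : R -> R, F 0 = 0 /\ forall x : R, is_derive x 1 F (f x).
Proof.
move=> cf.
have [F HF] := @primitive_right f (-1) cf.
have [|G HG] := @primitive_right (fun x => f (- x)) (-1).
  move=> x; have -> : (fun x => f (- x)) = f \o -%R by [].
  by apply: continuous_comp; [exact: opp_continuous|exact: cf].
pose F1 x := F x - F 0; pose G1 x := G 0 - G (- x).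
have HF1 (x : R) : -1 < x -> is_derive x 1 F1 (f x).
  move=> /HF h; have -> : F1 = F - cst (F 0) by [].
  by apply: is_derive_eq (is_deriveB h (is_derive_cst _ _ _)) _; rewrite subr0.
have HG1 (x : R) : x < 1 -> is_derive x 1 G1 (f x).
  move=> x1; have /is_derive_flip h := HG (- x) (ltac:(lra)).
  have -> : G1 = cst (G 0) - (fun t => G (- t)) by [].
  apply: is_derive_eq (is_deriveB (is_derive_cst _ _ _) h) _.
  by rewrite sub0r !opprK.
(* Both primitives vanish at 0 and have the same derivative on the overlap, so they agree there. *)
have FG (x : R) : -1 < x < 1 -> F1 x = G1 x.
  move=> x1; pose D := F1 - G1.
  have HD (t : R) : -1 < t < 1 -> is_derive t 1 D 0.
    move=> /andP[t1 t2]; apply: is_derive_eq (is_deriveB (HF1 _ t1) (HG1 _ t2)) _.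
    by rewrite subrr.
  have D0 : D 0 = 0 by rewrite /D !fctE /F1 /G1 oppr0 !subrr.
  suff : D x = 0 by rewrite /D !fctE => /eqP; rewrite subr_eq0 => /eqP.
  have [x0|x0] := leP 0 x.
    by rewrite -D0; apply/esym/(is_derive0_cst x0) => t t1; apply: HD; lra.
  by rewrite -D0; apply: (is_derive0_cst (ltW x0)) => t t1; apply: HD; lra.
exists (fun x => if 0 < x then F1 x else G1 x); split.
  by rewrite ltxx /G1 oppr0 subrr.
(* Any cut strictly between -1 and 0 works: to its right both branches equal [F1] near x; otherwise
   every nearby t is negative and only [G1] occurs. *)
move=> x; have [x0|x0] := ltP (- 2^-1) x.
  apply: near_eq_is_derive (HF1 _ _); last by lra.
  near=> t; case: ifPn => //; rewrite -leNgt => t0; apply: FG.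
  suff : - 2^-1 < t by lra.
  by near: t; exact: lt_nbhsr.
apply: near_eq_is_derive (HG1 _ _); last by lra.
near=> t; have t0 : t < 0 by near: t; apply: lt_nbhsl; lra.
by rewrite ltNge ltW.
Unshelve. all: by end_near. Qed.

Lemma is_derive1_cvg f (x d : R) :
  h^-1 *: (f (h + x) - f x) @[h --> (0 : R)^'] --> d -> is_derive x 1 f d.
Proof.
have -> : (fun h => h^-1 *: (f (h + x) - f x)) =
          (fun h => h^-1 *: ((f \o shift x) (h *: (1 : R)) - f x)).
  by apply/funext => h; rewrite /= /shift /GRing.scale /= mulr1.
move=> H; apply: DeriveDef; first by apply/cvg_ex; exists d.
exact: cvg_lim H.
Qed.

Lemma geometric_small (K e : R) : 0 < e ->
  exists N0, forall N, (N0 <= N)%N -> K / 2 ^+ N <= e.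
Proof.
move=> e0.
have : geometric K (2^-1 : R) @ \oo --> 0.
  by apply: cvg_geometric; rewrite ger0_norm // invf_lt1 // ltr1n.
move/cvgrPdist_le => /(_ e e0)[N0 _ H]; exists N0 => N /H /=.
by rewrite sub0r normrN exprVn; apply: le_trans; rewrite ler_norm.
Qed.

(** With e n = 2K / 2^n one has e n - e (n+1) = K / 2^n, so u + e is nonincreasing and u - e
    nondecreasing. The common limit lies between them, which gives convergence and the error bound
    at once. *)
Lemma geometric_cauchy_lim (u : nat -> R) (K : R) :
  (forall n, `|u n.+1 - u n| <= K / 2 ^+ n) ->
  (u @ \oo --> limn u) /\ forall n, `|u n - limn u| <= 2 * K / 2 ^+ n.
Proof.
move=> H.
have K0 : 0 <= K by have := le_trans (normr_ge0 _) (H 0%N); rewrite divr1.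
pose e n : R := 2 * K / 2 ^+ n.
have eS n : e n.+1 = e n - K / 2 ^+ n.
  by rewrite /e exprS; field; rewrite expf_neq0.
have e_ge0 n : 0 <= e n by rewrite divr_ge0 ?mulr_ge0 ?exprn_ge0.
have e_cvg : e @ \oo --> 0.
  have -> : e = geometric (2 * K) 2^-1 by apply/funext => n; rewrite /e /= exprVn.
  by apply: cvg_geometric; rewrite ger0_norm // invf_lt1 // ltr1n.
pose v n := u n + e n; pose w n := u n - e n.
have v_ni : nonincreasing_seq v.
  apply/nonincreasing_seqP => n; rewrite /v eS.
  by have := H n; rewrite ler_norml; lra.
have w_nd : nondecreasing_seq w.
  apply/nondecreasing_seqP => n; rewrite /w eS.
  by have := H n; rewrite ler_norml; lra.
have w_cvg : cvgn w.
  apply: (nondecreasing_is_cvgn w_nd); exists (v 0%N) => _ [n _ <-].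
  by apply: le_trans (v_ni _ _ (leq0n n)); rewrite /v /w; have := e_ge0 n; lra.
have u_cvg : u @ \oo --> limn w.
  have -> : u = w \+ e by apply/funext => n; rewrite /= /w subrK.
  by rewrite -[X in _ --> X]addr0; apply: cvgD.
have uw : limn u = limn w by apply: cvg_lim.
have v_cvg : v @ \oo --> limn u.
  by rewrite uw -[X in _ --> X]addr0; apply: cvgD.
rewrite uw; split => // n; rewrite -uw -/(e n).
have h1 := nondecreasing_cvgn_le w_nd w_cvg n.
have h2 : limn v <= v n.
  by apply: nonincreasing_cvgn_ge => //; apply/cvg_ex; exists (limn u).
rewrite (cvg_lim _ v_cvg) // in h2.
by rewrite ler_norml; move: h1 h2; rewrite -uw /v /w; lra.
Qed.

Lemma is_derive_lim (F G : nat -> R -> R) (K T : R) :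
  (forall n (x : R), is_derive x 1 (F n) (G n x)) ->
  (forall n (x : R), {for x, continuous (G n)}) ->
  (forall n x, `|x| < T -> `|F n.+1 x - F n x| <= K / 2 ^+ n) ->
  (forall n x, `|x| < T -> `|G n.+1 x - G n x| <= K / 2 ^+ n) ->
  forall x : R, `|x| < T ->
  is_derive x 1 (fun y => limn (F ^~ y)) (limn (G ^~ x)).
Proof.
move=> HF cG HFK HGK x xT; apply: is_derive1_cvg.
pose f y := limn (F ^~ y); pose g y := limn (G ^~ y).
have Fb n y : `|y| < T -> `|F n y - f y| <= 2 * K / 2 ^+ n.
  by move=> yT; have [_ ] := geometric_cauchy_lim (fun n => HFK n y yT).
have Gb n y : `|y| < T -> `|G n y - g y| <= 2 * K / 2 ^+ n.
  by move=> yT; have [_ ] := geometric_cauchy_lim (fun n => HGK n y yT).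
(* Four errors e separate [G N y] from [g x], hence 4 e |h| on increments of [F N]; replacing f by
   [F N] at two points costs e |h| each. The total 6 e |h| stays below eps |h|. *)
apply/cvgrPdist_le => eps eps0; pose e := eps / 8.
have e0 : 0 < e by rewrite divr_gt0.
have [N0 HN0] := geometric_small (2 * K) e0.
have /cvgrPdist_le /(_ e e0) /= cGx := cG N0 x.
have [d /= d0 Hd] : \forall y \near x, `|G N0 x - G N0 y| <= e /\ `|y| < T.
  near=> y; split; first by near: y.
  have : - T < y < T.
    apply/andP; split; near: y; [apply: lt_nbhsr|apply: lt_nbhsl];
    by move: xT; rewrite ltr_norml; lra.
  by rewrite ltr_norml.
have {}Hd y : `|x - y| < d -> `|G N0 x - G N0 y| <= e /\ `|y| < T.
  by move=> h; apply: (Hd y).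
have key N y : (N0 <= N)%N -> `|x - y| < d -> `|G N y - g x| <= 4 * e.
  move=> N0N yd; have [h1 yT] := Hd y yd.
  have := le_trans (Gb N y yT) (HN0 N N0N).
  have := le_trans (Gb N0 y yT) (HN0 N0 (leqnn _)).
  have := le_trans (Gb N0 x xT) (HN0 N0 (leqnn _)).
  by move: h1; rewrite !ler_norml; lra.
have incr N a b : a <= b -> (N0 <= N)%N ->
    (forall y, a <= y <= b -> `|x - y| < d) ->
    `|F N b - F N a - (b - a) * g x| <= 4 * e * (b - a).
  move=> ab N0N Hab.
  have D1 (t : R) : is_derive t 1 (F N - g x *: id) (G N t - g x *: 1).
    by apply: is_deriveB; apply: is_deriveZ.
  have D2 (t : R) : is_derive t 1 ((4 * e) *: id) ((4 * e) *: (1 : R)).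
    exact: is_deriveZ.
  have := norm_increment_le ab (fun t _ => D1 t) (fun t _ => D2 t).
  rewrite !fctE /GRing.scale /= !mulr1 => h.
  have -> : F N b - F N a - (b - a) * g x =
     F N b - g x * b - (F N a - g x * a) by ring.
  by rewrite mulrBr; apply: h => t /Hab; apply: key.
near=> h.
have h0 : h != 0 by near: h; exact: nbhs_dnbhs_neq.
have hd : `|h| < d by near: h; apply: dnbhs0_lt.
have inc N : (N0 <= N)%N -> `|F N (h + x) - F N x - h * g x| <= 4 * e * `|h|.
  move=> N0N; have [h_ge0|h_lt0] := leP 0 h.
    have := @incr N x (h + x) _ N0N.
    rewrite addrK (ger0_norm h_ge0) => Hi; apply: Hi; first by rewrite lerDr.
    by move=> y yh; move: hd; rewrite ger0_norm // ltr_norml; lra.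
  have := @incr N (h + x) x _ N0N.
  rewrite opprD addrCA subrr addr0 (ltr0_norm h_lt0) => Hi.
  have -> : F N (h + x) - F N x - h * g x = - (F N x - F N (h + x) - - h * g x).
    by ring.
  rewrite normrN; apply: Hi; first by lra.
  by move=> y yh; move: hd; rewrite ltr0_norm // ltr_norml; lra.
have h_gt0 : 0 < `|h| by rewrite normr_gt0.
(* [N1] may depend on h: the increment bound holds for all N >= N0, and N serves only to pass from
   [F N] to f for this one h. *)
have [N1 HN1] := @geometric_small (2 * K) (e * `|h|) (mulr_gt0 e0 h_gt0).
pose N := maxn N0 N1.
have hxT : `|h + x| < T.
  by apply: (Hd _ _).2; rewrite opprD addrCA subrr addr0 normrN.
have i1 := inc N (leq_maxl _ _).
have i2 := le_trans (Fb N _ hxT) (HN1 N (leq_maxr _ _)).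
have i3 := le_trans (Fb N _ xT) (HN1 N (leq_maxr _ _)).
have fin : `|f (h + x) - f x - h * g x| <= eps * `|h|.
  have -> : eps = 8 * e by rewrite /e mulrC divfK.
  move: i1 i2 i3; rewrite !ler_norml.
  have := mulr_gt0 e0 h_gt0; rewrite -!mulrA.
  by set z := e * `|h|; lra.
rewrite distrC -/(f _) -/(f _) -/(g _) /GRing.scale /=.
have -> : h^-1 * (f (h + x) - f x) - g x = h^-1 * (f (h + x) - f x - h * g x).
  by field.
by rewrite normrM normfV mulrC ler_pdivrMr.
Unshelve. all: by end_near. Qed.

(** Integrating the weight e^(L|x|) gains a factor 1/L independent of T. This is Bielecki's device
    for making Picard iteration contract on intervals of any length. *)
Lemma weighted_increment_le f (df : R -> R) (c L T : R) : 0 < L -> 0 <= c ->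
  (forall x : R, is_derive x 1 f (df x)) -> f 0 = 0 ->
  (forall x, `|x| <= T -> `|df x| <= c * expR (L * `|x|)) ->
  forall x, `|x| <= T -> `|f x| <= c / L * expR (L * `|x|).
Proof.
move=> L0 c0.
have pos (k : R -> R) dk t : (forall x : R, is_derive x 1 k (dk x)) -> k 0 = 0 ->
  (forall x, `|x| <= T -> `|dk x| <= c * expR (L * `|x|)) -> 0 <= t <= T ->
  `|k t| <= c / L * expR (L * t).
  move=> Hk k0 Hdk /andP[t0 tT].
  have De (x : R) : is_derive x 1 ((c / L) *: (expR \o (L *: id)))
     (c * expR (L * x)).
    have D : is_derive x 1 (expR \o (L *: id)) (expR (L * x) * (L *: 1)).
      by apply: is_derive1_comp; exact: is_derive_expR.
    apply: is_derive_eq (is_deriveZ (c / L) D) _.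
    by rewrite /GRing.scale /= mulr1; field; rewrite gt_eqF.
  have := norm_increment_le t0 (fun x _ => Hk x) (fun x _ => De x).
  rewrite !fctE /= !/(GRing.scale _ _) /= mulr0 k0 subr0 expR0 mulr1 => h.
  apply: le_trans (h _) _.
    move=> x /andP[x0 xt].
    by rewrite -{2}(ger0_norm x0); apply: Hdk; rewrite ger0_norm //; lra.
  by rewrite lerBlDr lerDl divr_ge0 // ltW.
move=> Hf f0 Hdf x xT; have [x0|x0] := leP 0 x.
  rewrite (ger0_norm x0); apply: (pos f df) => //.
  by move: xT; rewrite ger0_norm // x0.
rewrite (ltr0_norm x0).
have := pos (fun t => f (- t)) (fun t => - df (- t)) (- x).
rewrite /= opprK; apply.
- by move=> t; exact: is_derive_flip (Hf (- t)).
- by rewrite oppr0.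
- by move=> t tT; rewrite normrN -(normrN t); apply: Hdf; rewrite normrN.
- by move: xT; rewrite (ltr0_norm x0) oppr_ge0 (ltW x0).
Qed.

End RealAnalysis.

(** * Limits and derivatives of complex matrices through real and imaginary parts *)

Section ComplexCalculus.
Variable R : realType.
Local Notation C := R[i].
Local Notation Re := (@complex.Re R).
Local Notation Im := (@complex.Im R).

Lemma cReD (x y : C) : Re (x + y) = Re x + Re y. Proof. by case: x y => ? ? []. Qed.
Lemma cImD (x y : C) : Im (x + y) = Im x + Im y. Proof. by case: x y => ? ? []. Qed.
Lemma cReM (x y : C) : Re (x * y) = Re x * Re y - Im x * Im y.
Proof. by case: x y => ? ? []. Qed.
Lemma cImM (x y : C) : Im (x * y) = Re x * Im y + Im x * Re y.
Proof. by case: x y => ? ? []. Qed.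
Lemma cReN (x : C) : Re (- x) = - Re x. Proof. by case: x. Qed.
Lemma cImN (x : C) : Im (- x) = - Im x. Proof. by case: x. Qed.
Lemma cRe_conj (x : C) : Re x^* = Re x. Proof. by case: x. Qed.
Lemma cIm_conj (x : C) : Im x^* = - Im x. Proof. by case: x. Qed.
Lemma complex_ext (x y : C) : Re x = Re y -> Im x = Im y -> x = y.
Proof. by case: x y => ? ? [? ?] /= -> ->. Qed.

Section Convergence.
Context {T : Type} {F : set_system T} {FF : Filter F}.

Definition ccvg (f : T -> C) (c : C) : Prop :=
  ((fun t => Re (f t)) @ F --> Re c) /\ ((fun t => Im (f t)) @ F --> Im c).

Lemma ccvg_cst c : ccvg (cst c) c.
Proof. by split; exact: cvg_cst. Qed.

Lemma ccvgD f g c d : ccvg f c -> ccvg g d -> ccvg (fun t => f t + g t) (c + d).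
Proof.
move=> [f1 f2] [g1 g2]; split.
  by rewrite cReD (_ : (fun t => _) = (fun t => Re (f t) + Re (g t)));
    [exact: cvgD|apply/funext => t; rewrite cReD].
by rewrite cImD (_ : (fun t => _) = (fun t => Im (f t) + Im (g t)));
  [exact: cvgD|apply/funext => t; rewrite cImD].
Qed.

Lemma ccvgM f g c d : ccvg f c -> ccvg g d -> ccvg (fun t => f t * g t) (c * d).
Proof.
move=> [f1 f2] [g1 g2]; split.
  rewrite cReM (_ : (fun t => _) =
      (fun t => Re (f t) * Re (g t) - Im (f t) * Im (g t))).
    by apply: cvgB; exact: cvgM.
  by apply/funext => t; rewrite cReM.
rewrite cImM (_ : (fun t => _) =
    (fun t => Re (f t) * Im (g t) + Im (f t) * Re (g t))).
  by apply: cvgD; exact: cvgM.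
by apply/funext => t; rewrite cImM.
Qed.

Lemma ccvg_sum (J : Type) (r : seq J) (f : J -> T -> C) (c : J -> C) :
  (forall j, ccvg (f j) (c j)) ->
  ccvg (fun t => \sum_(j <- r) f j t) (\sum_(j <- r) c j).
Proof.
move=> H; elim: r => [|j r IH].
  rewrite big_nil (_ : (fun t => _) = cst 0); first exact: ccvg_cst.
  by apply/funext => t; rewrite big_nil.
rewrite big_cons (_ : (fun t => _) =
    (fun t => f j t + \sum_(j <- r) f j t)); first exact: ccvgD.
by apply/funext => t; rewrite big_cons.
Qed.

Definition mcvg m p (f : T -> 'M[C]_(m, p)) (A : 'M[C]_(m, p)) : Prop :=
  forall i j, ccvg (fun t => f t i j) (A i j).

Lemma mcvg_cst m p (A : 'M[C]_(m, p)) : mcvg (cst A) A.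
Proof. by move=> i j; exact: ccvg_cst. Qed.

Lemma mcvgM m p q (f : T -> 'M[C]_(m, p)) (g : T -> 'M[C]_(p, q)) A B :
  mcvg f A -> mcvg g B -> mcvg (fun t => f t *m g t) (A *m B).
Proof.
move=> fA gB i j; rewrite mxE.
rewrite (_ : (fun t => _) = (fun t => \sum_k f t i k * g t k j)).
  by apply: ccvg_sum => k; apply: ccvgM.
by apply/funext => t; rewrite mxE.
Qed.

Lemma mcvg_sum m p (J : Type) (r : seq J) (f : J -> T -> 'M[C]_(m, p)) A :
  (forall j, mcvg (f j) (A j)) ->
  mcvg (fun t => \sum_(j <- r) f j t) (\sum_(j <- r) A j).
Proof.
move=> H i j; rewrite summxE.
rewrite (_ : (fun t => _) = (fun t => \sum_(k <- r) f k t i j)).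
  by apply: (@ccvg_sum _ _ (fun k t => f k t i j)) => k; exact: H.
by apply/funext => t; rewrite summxE.
Qed.

Lemma mcvgD m p (f g : T -> 'M[C]_(m, p)) A B :
  mcvg f A -> mcvg g B -> mcvg (fun t => f t + g t) (A + B).
Proof.
move=> fA gB i j; rewrite mxE.
rewrite (_ : (fun t => _) = (fun t => f t i j + g t i j)); first exact: ccvgD.
by apply/funext => t; rewrite mxE.
Qed.

Lemma mcvgZ m p (f : T -> 'M[C]_(m, p)) A (k : T -> C) c :
  ccvg k c -> mcvg f A -> mcvg (fun t => k t *: f t) (c *: A).
Proof.
move=> kc fA i j; rewrite mxE.
rewrite (_ : (fun t => _) = (fun t => k t * f t i j)); first exact: ccvgM.
by apply/funext => t; rewrite mxE.
Qed.

Lemma mcvgN m p (f : T -> 'M[C]_(m, p)) A :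
  mcvg f A -> mcvg (fun t => - f t) (- A).
Proof.
move=> fA; rewrite -scaleN1r (_ : (fun t => _) = (fun t => -1 *: f t)).
  by apply: mcvgZ => //; exact: ccvg_cst.
by apply/funext => t; rewrite scaleN1r.
Qed.

Lemma mcvg_tr m p (f : T -> 'M[C]_(m, p)) A :
  mcvg f A -> mcvg (fun t => (f t)^T) A^T.
Proof.
move=> fA i j; rewrite mxE (_ : (fun t => _) = (fun t => f t j i)) //.
by apply/funext => t; rewrite mxE.
Qed.

End Convergence.

Definition mcont m p (f : R -> 'M[C]_(m, p)) (t : R) : Prop :=
  @mcvg R (nbhs t) m p f (f t).

Definition cder (f : R -> C) (t : R) (c : C) : Prop :=
  is_derive t 1 (fun s => Re (f s)) (Re c) /\
  is_derive t 1 (fun s => Im (f s)) (Im c).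

Lemma cder_cst (c : C) t : cder (cst c) t 0.
Proof. by split; exact: is_derive_cst. Qed.

Lemma cderD f g t c d : cder f t c -> cder g t d ->
  cder (fun t => f t + g t) t (c + d).
Proof.
move=> [f1 f2] [g1 g2]; split.
  rewrite cReD (_ : (fun t => _) = (fun t => Re (f t)) + (fun t => Re (g t))).
    exact: is_deriveD.
  by apply/funext => s; rewrite cReD.
rewrite cImD (_ : (fun t => _) = (fun t => Im (f t)) + (fun t => Im (g t))).
  exact: is_deriveD.
by apply/funext => s; rewrite cImD.
Qed.

Lemma cderM f g (t : R) c d : cder f t c -> cder g t d ->
  cder (fun t => f t * g t) t (c * g t + f t * d).
Proof.
move=> [f1 f2] [g1 g2]; split.
  rewrite (_ : (fun t => _) = (fun t => Re (f t)) * (fun t => Re (g t)) -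
     (fun t => Im (f t)) * (fun t => Im (g t))).
    apply: is_derive_eq (is_deriveB (is_deriveM f1 g1) (is_deriveM f2 g2)) _.
    by rewrite cReD !cReM /GRing.scale /=; ring.
  by apply/funext => s; rewrite cReM.
rewrite (_ : (fun t => _) = (fun t => Re (f t)) * (fun t => Im (g t)) +
     (fun t => Im (f t)) * (fun t => Re (g t))).
  apply: is_derive_eq (is_deriveD (is_deriveM f1 g2) (is_deriveM f2 g1)) _.
  by rewrite cImD !cImM /GRing.scale /=; ring.
by apply/funext => s; rewrite cImM.
Qed.

Lemma cder_sum (J : Type) (r : seq J) (f : J -> R -> C) (t : R) (c : J -> C) :
  (forall j, cder (f j) t (c j)) ->
  cder (fun t => \sum_(j <- r) f j t) t (\sum_(j <- r) c j).
Proof.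
move=> H; elim: r => [|j r IH].
  rewrite big_nil (_ : (fun t => _) = cst 0); first exact: cder_cst.
  by apply/funext => s; rewrite big_nil.
rewrite big_cons (_ : (fun t => _) =
    (fun t => f j t + \sum_(j <- r) f j t)); first exact: cderD.
by apply/funext => s; rewrite big_cons.
Qed.

Lemma cder_conj f t c : cder f t c -> cder (fun t => (f t)^*) t c^*.
Proof.
move=> [f1 f2]; split.
  rewrite cRe_conj (_ : (fun t => _) = (fun t => Re (f t))) //.
  by apply/funext => s; rewrite cRe_conj.
rewrite cIm_conj (_ : (fun t => _) = - (fun t => Im (f t))).
  exact: is_deriveN.
by apply/funext => s; rewrite cIm_conj.
Qed.

Lemma cder_comp f (phi : R -> R) (t d : R) c :
  cder f (phi t) c -> is_derive t 1 phi d ->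
  cder (fun t => f (phi t)) t (d%:C%C * c).
Proof.
move=> [f1 f2] pd; split.
  have -> : Re (d%:C%C * c) = Re c * d by rewrite cReM /=; ring.
  exact: (is_derive1_comp f1 pd).
have -> : Im (d%:C%C * c) = Im c * d by rewrite cImM /=; ring.
exact: (is_derive1_comp f2 pd).
Qed.

Lemma cder_real (phi : R -> R) (t d : R) :
  is_derive t 1 phi d -> cder (fun t => (phi t)%:C%C) t d%:C%C.
Proof. by move=> pd; split => //=; exact: is_derive_cst. Qed.

Lemma cder_cvg f (t : R) c : cder f t c -> @ccvg R (nbhs t) f (f t).
Proof.
by move=> [f1 f2]; split; [exact: is_derive1_continuous f1|
  exact: is_derive1_continuous f2].
Qed.

(** A relation rather than an operator, so that differentiability and the value of the derivative
    travel together; [mder_mx_deriv] and [mx_deriv_mder] translate to and from [mx_deriv]. *)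
Definition mder m p (f : R -> 'M[C]_(m, p)) (t : R) (D : 'M[C]_(m, p)) : Prop :=
  forall i j, cder (fun s => f s i j) t (D i j).

Lemma mder_eq m p (f g : R -> 'M[C]_(m, p)) t D D' :
  mder f t D -> f =1 g -> D = D' -> mder g t D'.
Proof. by move=> fD /funext <- <-. Qed.

Lemma mder_cst m p (A : 'M[C]_(m, p)) t : mder (cst A) t 0.
Proof. by move=> i j; rewrite mxE; exact: cder_cst. Qed.

Lemma mderD m p (f g : R -> 'M[C]_(m, p)) t A B :
  mder f t A -> mder g t B -> mder (fun t => f t + g t) t (A + B).
Proof.
move=> fA gB i j; rewrite mxE.
rewrite (_ : (fun t => _) = (fun t => f t i j + g t i j)); first exact: cderD.
by apply/funext => s; rewrite mxE.
Qed.

Lemma mderZ m p (f : R -> 'M[C]_(m, p)) t A (k : R -> C) c :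
  cder k t c -> mder f t A -> mder (fun t => k t *: f t) t (c *: f t + k t *: A).
Proof.
move=> kc fA i j; rewrite !mxE.
rewrite (_ : (fun t => _) = (fun t => k t * f t i j)); first exact: cderM.
by apply/funext => s; rewrite mxE.
Qed.

Lemma mderN m p (f : R -> 'M[C]_(m, p)) t A :
  mder f t A -> mder (fun t => - f t) t (- A).
Proof.
move=> fA; apply: mder_eq (mderZ (cder_cst (-1) t) fA) _ _.
  by move=> s; rewrite /cst scaleN1r.
by rewrite scale0r add0r scaleN1r.
Qed.

Lemma mderB m p (f g : R -> 'M[C]_(m, p)) t A B :
  mder f t A -> mder g t B -> mder (fun t => f t - g t) t (A - B).
Proof. by move=> fA gB; apply: mderD => //; exact: mderN. Qed.

Lemma mderM m p q (f : R -> 'M[C]_(m, p)) (g : R -> 'M[C]_(p, q)) (t : R) A B :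
  mder f t A -> mder g t B -> mder (fun t => f t *m g t) t (A *m g t + f t *m B).
Proof.
move=> fA gB i j; rewrite !mxE -big_split /=.
rewrite (_ : (fun t => _) = (fun t => \sum_k f t i k * g t k j)).
  by apply: (@cder_sum _ _ (fun k t => f t i k * g t k j)) => k; apply: cderM.
by apply/funext => s; rewrite mxE.
Qed.

Lemma mderMl m p q (A : 'M[C]_(m, p)) (g : R -> 'M[C]_(p, q)) (t : R) B :
  mder g t B -> mder (fun t => A *m g t) t (A *m B).
Proof.
by move=> gB; apply: mder_eq (mderM (mder_cst A t) gB) _ _ => //;
  rewrite mul0mx add0r.
Qed.

Lemma mderMr m p q (f : R -> 'M[C]_(m, p)) (B : 'M[C]_(p, q)) (t : R) A :
  mder f t A -> mder (fun t => f t *m B) t (A *m B).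
Proof.
by move=> fA; apply: mder_eq (mderM fA (mder_cst B t)) _ _ => //;
  rewrite mulmx0 addr0.
Qed.

Lemma mder_tr m p (f : R -> 'M[C]_(m, p)) t A :
  mder f t A -> mder (fun t => (f t)^T) t A^T.
Proof.
move=> fA i j; rewrite mxE (_ : (fun t => _) = (fun t => f t j i)) //.
by apply/funext => s; rewrite mxE.
Qed.

Lemma mder_conjm n (f : R -> 'M[C]_n) t A :
  mder f t A -> mder (fun t => conjm (f t)) t (conjm A).
Proof.
move=> fA i j; rewrite mxE (_ : (fun t => _) = (fun t => (f t i j)^*)).
  exact: cder_conj.
by apply/funext => s; rewrite mxE.
Qed.

Lemma mder_comp m p (f : R -> 'M[C]_(m, p)) (phi : R -> R) (t d : R) A :
  mder f (phi t) A -> is_derive t 1 phi d ->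
  mder (fun t => f (phi t)) t (d%:C%C *: A).
Proof. by move=> fA pd i j; rewrite mxE; exact: (cder_comp (fA i j) pd). Qed.

Lemma mder_sum m p (J : Type) (r : seq J) (f : J -> R -> 'M[C]_(m, p)) (t : R) A :
  (forall j, mder (f j) t (A j)) ->
  mder (fun t => \sum_(j <- r) f j t) t (\sum_(j <- r) A j).
Proof.
move=> H i j; rewrite summxE.
rewrite (_ : (fun t => _) = (fun t => \sum_(k <- r) f k t i j)).
  by apply: (@cder_sum _ _ (fun k t => f k t i j)) => k; exact: H.
by apply/funext => s; rewrite summxE.
Qed.

Lemma mder_cont m p (f : R -> 'M[C]_(m, p)) t A : mder f t A -> mcont f t.
Proof. by move=> fA i j; exact: cder_cvg (fA i j). Qed.

Lemma mder_unique m p (f : R -> 'M[C]_(m, p)) t A B :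
  mder f t A -> mder f t B -> A = B.
Proof.
move=> fA fB; apply/matrixP => i j.
have [[_ a1] [_ a2]] := fA i j; have [[_ b1] [_ b2]] := fB i j.
by apply: complex_ext; rewrite -?a1 -?a2 -?b1 -?b2.
Qed.

Lemma mder0_cst m p (f : R -> 'M[C]_(m, p)) (a : R) :
  (forall t, a < t -> mder f t 0) ->
  forall s t, a < s -> a < t -> f s = f t.
Proof.
move=> H; suff W s t : a < s -> s <= t -> f s = f t.
  move=> s t sa ta; have [st|/ltW ts] := leP s t; first exact: W.
  by apply/esym; exact: W.
move=> sa st; apply/matrixP => i j; apply: complex_ext.
  apply: (@is_derive0_cst _ (fun t => Re (f t i j))) => // x /andP[sx _].
  by have [+ _] := H x (lt_le_trans sa sx) i j; rewrite mxE.
apply: (@is_derive0_cst _ (fun t => Im (f t i j))) => // x /andP[sx _].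
by have [_] := H x (lt_le_trans sa sx) i j; rewrite mxE.
Qed.

Lemma mder_mx_deriv n (f : R -> 'M[C]_n) t A :
  mder f t A -> mx_derivable f t /\ mx_deriv f t = A.
Proof.
move=> fA; split.
  by move=> i j; have [[? _] [? _]] := fA i j.
apply/matrixP => i j; rewrite mxE; have [[_ a1] [_ a2]] := fA i j.
by rewrite a1 a2; case: (A i j).
Qed.

Lemma mx_deriv_mder n (f : R -> 'M[C]_n) t :
  mx_derivable f t -> mder f t (mx_deriv f t).
Proof.
by move=> fd i j; have [f1 f2] := fd i j; split; rewrite mxE /=; apply: derivableP.
Qed.

End ComplexCalculus.

(** * Convergence of the Peano-Baker series and its derivative *)

Section LinearODE.
Variable R : realType.
Local Notation C := R[i].
Local Notation Re := (@complex.Re R).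
Local Notation Im := (@complex.Im R).

Definition mbnd m p (A : 'M[C]_(m, p)) (b : R) : Prop :=
  forall i j, `|Re (A i j)| <= b /\ `|Im (A i j)| <= b.

Lemma cRe_sum (J : Type) (r : seq J) (f : J -> C) :
  Re (\sum_(j <- r) f j) = \sum_(j <- r) Re (f j).
Proof.
by elim: r => [|j r IH]; rewrite ?big_nil // !big_cons cReD IH.
Qed.

Lemma cIm_sum (J : Type) (r : seq J) (f : J -> C) :
  Im (\sum_(j <- r) f j) = \sum_(j <- r) Im (f j).
Proof.
by elim: r => [|j r IH]; rewrite ?big_nil // !big_cons cImD IH.
Qed.

Lemma cRe_subE m p (X Y : 'M[C]_(m, p)) i j :
  Re ((X - Y) i j) = Re (X i j) - Re (Y i j).
Proof. by rewrite !mxE cReD cReN. Qed.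

Lemma cIm_subE m p (X Y : 'M[C]_(m, p)) i j :
  Im ((X - Y) i j) = Im (X i j) - Im (Y i j).
Proof. by rewrite !mxE cImD cImN. Qed.

(** [p] counts the summands of an entry, and 2 the real products in the real or imaginary part of a
    complex product. *)
Lemma mbndM m p q (A : 'M[C]_(m, p)) (B : 'M[C]_(p, q)) b c :
  mbnd A b -> mbnd B c -> mbnd (A *m B) (p%:R * (2 * (b * c))).
Proof.
move=> Ab Bc i j.
have pr (x y : R) : `|x| <= b -> `|y| <= c -> `|x * y| <= b * c.
  by move=> xb yc; rewrite normrM ler_pM.
have E : p%:R * (2 * (b * c)) = \sum_(k < p) (2 * (b * c)).
  by rewrite sumr_const card_ord -[RHS]mulr_natl.
rewrite mxE cRe_sum cIm_sum E; split; apply: le_trans (ler_norm_sum _ _ _) _;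
  apply: ler_sum => k _; have [a1 a2] := Ab i k; have [b1 b2] := Bc k j.
- rewrite cReM mulr_natl mulr2n (le_trans (ler_normB _ _)) //.
  by apply: lerD; exact: pr.
- rewrite cImM mulr_natl mulr2n (le_trans (ler_normD _ _)) //.
  by apply: lerD; exact: pr.
Qed.

Lemma continuous_bounded (f : R -> R) (T : R) :
  (forall x : R, {for x, continuous f}) ->
  exists M, 0 <= M /\ forall x, `|x| <= T -> `|f x| <= M.
Proof.
move=> cf; have [T0|T0] := leP 0 T; last first.
  exists 0; split => // x xT.
  by have := le_lt_trans (le_trans (normr_ge0 x) xT) T0; rewrite ltxx.
have [||c _ H] := @EVT_max R (fun x => `|f x|) (- T) T.
  by lra.
  apply: continuous_subspaceT => x.
  by apply: continuous_comp; [exact: cf|exact: norm_continuous].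
exists `|f c|; split => // x; rewrite ler_norml => xT.
by apply: H; rewrite in_itv.
Qed.

Lemma mcont_bounded m p (A : R -> 'M[C]_(m, p)) (T : R) :
  (forall t, mcont A t) ->
  exists M, 0 <= M /\ forall t, `|t| <= T -> mbnd (A t) M.
Proof.
move=> cA.
have /choice[M HM] : forall ij : 'I_m * 'I_p, exists M, 0 <= M /\
    forall t, `|t| <= T -> `|Re (A t ij.1 ij.2)| <= M /\ `|Im (A t ij.1 ij.2)| <= M.
  move=> [i j] /=.
  have [|M1 [M10 H1]] := @continuous_bounded (fun t => Re (A t i j)) T.
    by move=> x; have [] := cA x i j.
  have [|M2 [M20 H2]] := @continuous_bounded (fun t => Im (A t i j)) T.
    by move=> x; have [] := cA x i j.
  exists (M1 + M2); split; first exact: addr_ge0.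
  by move=> t tT; split; [have := H1 t tT|have := H2 t tT]; lra.
exists (\sum_ij M ij); split; first by apply: sumr_ge0 => ij _; case: (HM ij).
move=> t tT i j; have [_ /(_ t tT) /= [h1 h2]] := HM (i, j).
have le : M (i, j) <= \sum_ij M ij.
  rewrite (bigD1 (i, j)) //= lerDl; apply: sumr_ge0 => ij _; by case: (HM ij).
by split; [exact: le_trans h1 le|exact: le_trans h2 le].
Qed.

Definition mxlim n (S : nat -> 'M[C]_n) : 'M[C]_n :=
  \matrix_(i, j) (limn (fun N => Re (S N i j)) +i* limn (fun N => Im (S N i j)))%C.

Section Peano.
Variables (n : nat) (A : R -> 'M[C]_n) (Z : nat -> R -> 'M[C]_n).
Hypothesis contA : forall t, mcont A t.
Hypothesis Z0 : forall t, Z 0 t = 1%:M.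
Hypothesis ZS : forall k t, mder (Z k.+1) t (Z k t *m A t).
Hypothesis ZS0 : forall k, Z k.+1 0 = 0.

Let S N t := \sum_(k < N) Z k t.

(* The weight e^(L|t|) makes each Picard step halve the bound. *)
Lemma peano_bound (T M : R) : 0 <= M ->
  (forall t, `|t| <= T -> mbnd (A t) M) ->
  exists L, 0 < L /\
    forall k t, `|t| <= T -> mbnd (Z k t) (expR (L * `|t|) / 2 ^+ k).
Proof.
(* Multiplication by A costs 2 n M by [mbndM] and integration gains 1/L, so halving needs L >= 4 n
   M; the extra 1 keeps L positive when n M = 0. *)
move=> M0 HM; pose L := 4 * n%:R * M + 1.
have nM : 0 <= n%:R * M by rewrite mulr_ge0.
have L0 : 0 < L by rewrite /L -mulrA; lra.
exists L; split => // k; elim: k => [|k IH] t tT.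
  have e1 : 1 <= expR (L * `|t|).
    rewrite -[X in X <= _](@expR0 R) ler_expR.
    by rewrite mulr_ge0 // ltW.
  move=> i j; rewrite Z0 expr0 divr1 mxE.
  by case: (i == j) => /=; rewrite ?mulr1n ?normr0 ?normr1; split => //;
    apply: le_trans e1.
pose c := L / 2 / 2 ^+ k.
have c0 : 0 <= c.
  by rewrite !divr_ge0 ?exprn_ge0 // ltW.
have bd s : `|s| <= T -> mbnd (Z k s *m A s) (c * expR (L * `|s|)).
  move=> sT i j.
  have le : n%:R * (2 * (expR (L * `|s|) / 2 ^+ k * M)) <= c * expR (L * `|s|).
    have -> : n%:R * (2 * (expR (L * `|s|) / 2 ^+ k * M)) =
      (2 * (n%:R * M)) * (expR (L * `|s|) / 2 ^+ k).
      by ring.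
    have -> : c * expR (L * `|s|) = (L / 2) * (expR (L * `|s|) / 2 ^+ k).
      by rewrite /c -!mulrA; congr (_ * (_ * _)); rewrite mulrC.
    apply: ler_wpM2r; first by rewrite divr_ge0 ?expR_ge0 ?exprn_ge0.
    by rewrite /L -mulrA; lra.
  have [h1 h2] := mbndM (IH s sT) (HM s sT) i j.
  by split; [exact: le_trans h1 le|exact: le_trans h2 le].
have -> : expR (L * `|t|) / 2 ^+ k.+1 = c / L * expR (L * `|t|).
  rewrite /c exprS; field.
  by rewrite expf_neq0 //= gt_eqF.
move=> i j; split.
  apply: (@weighted_increment_le R (fun s => Re (Z k.+1 s i j))
    (fun s => Re ((Z k s *m A s) i j)) c L T) => //.
  - by move=> s; have [] := @ZS k s i j.
  - by rewrite ZS0 mxE.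
  - by move=> s sT; have [] := bd s sT i j.
apply: (@weighted_increment_le R (fun s => Im (Z k.+1 s i j))
    (fun s => Im ((Z k s *m A s) i j)) c L T) => //.
- by move=> s; have [] := @ZS k s i j.
- by rewrite ZS0 mxE.
- by move=> s sT; have [] := bd s sT i j.
Qed.

(** A single K serves the partial sums and their products with A, since [is_derive_lim] wants one
    rate for functions and derivatives. *)
Lemma peano_tail (T : R) : exists K, forall N t, `|t| <= T ->
  mbnd (S N.+1 t - S N t) (K / 2 ^+ N) /\
  mbnd (S N.+1 t *m A t - S N t *m A t) (K / 2 ^+ N).
Proof.
have [M [M0 HM]] := mcont_bounded T contA.
have [L [L0 H]] := peano_bound M0 HM.
pose e := expR (L * T); exists (e + n%:R * (2 * (e * M))) => N t tT.
have nM : 0 <= n%:R * (2 * (e * M)) by rewrite !mulr_ge0 ?expR_ge0.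
have SE : S N.+1 t - S N t = Z N t.
  by rewrite /S big_ord_recr /= addrAC subrr add0r.
have bZ : mbnd (Z N t) (e / 2 ^+ N).
  have le : expR (L * `|t|) / 2 ^+ N <= e / 2 ^+ N.
    apply: ler_wpM2r; first by rewrite invr_ge0 exprn_ge0.
    by rewrite ler_expR ler_wpM2l // ltW.
  move=> i j; have [h1 h2] := H N t tT i j.
  by split; [exact: le_trans h1 le|exact: le_trans h2 le].
rewrite -mulmxBl SE; split => i j.
  have le : e / 2 ^+ N <= (e + n%:R * (2 * (e * M))) / 2 ^+ N.
    by apply: ler_wpM2r; [rewrite invr_ge0 exprn_ge0|rewrite lerDl].
  have [h1 h2] := bZ i j.
  by split; [exact: le_trans h1 le|exact: le_trans h2 le].
have le : n%:R * (2 * (e / 2 ^+ N * M)) <= (e + n%:R * (2 * (e * M))) / 2 ^+ N.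
  have -> : n%:R * (2 * (e / 2 ^+ N * M)) = n%:R * (2 * (e * M)) / 2 ^+ N by ring.
  apply: ler_wpM2r; first by rewrite invr_ge0 exprn_ge0.
  by rewrite lerDr expR_ge0.
have [h1 h2] := mbndM bZ (HM t tT) i j.
by split; [exact: le_trans h1 le|exact: le_trans h2 le].
Qed.

Lemma peano_cvg t : @mcvg R nat \oo n n (S ^~ t) (mxlim (S ^~ t)).
Proof.
have [K HK] := peano_tail `|t|.
move=> i j; rewrite mxE; split => /=.
  apply: (geometric_cauchy_lim (K := K) _).1 => N.
  by have [/(_ i j)[+ _] _] := HK N t (lexx _); rewrite cRe_subE.
apply: (geometric_cauchy_lim (K := K) _).1 => N.
by have [/(_ i j)[_ +] _] := HK N t (lexx _); rewrite cIm_subE.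
Qed.

Lemma peano_der t : mder (fun t => mxlim (S ^~ t)) t (mxlim (S ^~ t) *m A t).
Proof.
(* The margin 1 makes the uniform estimates valid on a neighbourhood of t. *)
pose T := `|t| + 1.
have tT : `|t| < T by rewrite ltrDl.
have [K HK] := peano_tail T.
(* Differentiation shifts the index: the constant term disappears, so S (N+1) is paired with S N A.
   The shift does not affect the limits. *)
have dS N s : mder (S N.+1) s (S N s *m A s).
  apply: (@mder_eq R n n _ _ s _ _ (@mder_sum R n n 'I_N.+1 (index_enum _)
    (fun k => Z k) s
    (fun k => if k == ord0 then 0 else Z k.-1 s *m A s) _)) => //.
    move=> [[|k] kN].
      rewrite (_ : Z _ = cst 1%:M); first exact: mder_cst.
      by apply/funext => u; rewrite Z0.
    exact: ZS.
  rewrite big_ord_recl add0r /S mulmx_suml.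
  by apply: eq_bigr => k _.
have cS N s : mcont (S N) s.
  case: N => [|N]; last exact: mder_cont (dS N s).
  have -> : S 0 = cst 0 by apply/funext => u; rewrite /S big_ord0.
  exact: mcvg_cst.
have cSA N s : mcont (fun s => S N s *m A s) s by apply: mcvgM; [exact: cS|exact: contA].
have HK1 N s : `|s| < T -> mbnd (S N.+2 s - S N.+1 s) (K / 2 ^+ N).
  move=> /ltW /(HK N.+1 s) [h _] i j; have [h1 h2] := h i j.
  have K0 : 0 <= K / 2 ^+ N.+1 by exact: le_trans (normr_ge0 _) h1.
  have le : K / 2 ^+ N.+1 <= K / 2 ^+ N.
    rewrite -subr_ge0; have -> // : K / 2 ^+ N - K / 2 ^+ N.+1 = K / 2 ^+ N.+1.
    by rewrite exprS; field; rewrite expf_neq0.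
  by split; [exact: le_trans h1 le|exact: le_trans h2 le].
have HK2 N s : `|s| < T ->
    mbnd (S N.+1 s *m A s - S N s *m A s) (K / 2 ^+ N).
  by move=> /ltW /(HK N s) [].
have limA : @mcvg R nat \oo n n (fun N => S N t *m A t) (mxlim (S ^~ t) *m A t).
  by apply: mcvgM; [exact: peano_cvg|exact: mcvg_cst].
move=> i j; split.
  rewrite (_ : (fun s => _) = fun s => limn (fun N => Re (S N.+1 s i j))); last first.
    apply/funext => s; rewrite mxE /=; apply/esym/cvg_lim => //.
    rewrite (@cvg_shiftS _ (fun N => Re (S N s i j))).
    by have [+ _] := peano_cvg s i j; rewrite mxE.
  rewrite -(cvg_lim _ (limA i j).1) //.
  apply: (@is_derive_lim R (fun N s => Re (S N.+1 s i j))
    (fun N s => Re ((S N s *m A s) i j)) K T) => //.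
  - by move=> N s; have [] := dS N s i j.
  - by move=> N s; have [] := cSA N s i j.
  - by move=> N s sT; have [+ _] := HK1 N s sT i j; rewrite cRe_subE.
  - move=> N s sT; have [+ _] := HK2 N s sT i j.
    by rewrite cRe_subE.
rewrite (_ : (fun s => _) = fun s => limn (fun N => Im (S N.+1 s i j))); last first.
  apply/funext => s; rewrite mxE /=; apply/esym/cvg_lim => //.
  rewrite (@cvg_shiftS _ (fun N => Im (S N s i j))).
  by have [_ +] := peano_cvg s i j; rewrite mxE.
rewrite -(cvg_lim _ (limA i j).2) //.
apply: (@is_derive_lim R (fun N s => Im (S N.+1 s i j))
    (fun N s => Im ((S N s *m A s) i j)) K T) => //.
- by move=> N s; have [] := dS N s i j.
- by move=> N s; have [] := cSA N s i j.
- by move=> N s sT; have [_ +] := HK1 N s sT i j; rewrite cIm_subE.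
- move=> N s sT; have [_ +] := HK2 N s sT i j.
  by rewrite cIm_subE.
Qed.

Lemma peano_init : mxlim (S ^~ 0) = 1%:M.
Proof.
have SE N : S N.+1 0 = 1%:M.
  rewrite /S big_ord_recl Z0 big1 ?addr0 // => k _; exact: ZS0.
apply/matrixP => i j; rewrite mxE; apply: complex_ext => /=.
  apply: cvg_lim => //.
  rewrite -(@cvg_shiftS _ (fun N => Re (S N 0 i j))).
  rewrite (_ : (fun N => _) = cst (Re ((1%:M : 'M[C]_n) i j))); first exact: cvg_cst.
  by apply/funext => N; rewrite /= SE.
apply: cvg_lim => //.
rewrite -(@cvg_shiftS _ (fun N => Im (S N 0 i j))).
rewrite (_ : (fun N => _) = cst (Im ((1%:M : 'M[C]_n) i j))); first exact: cvg_cst.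
by apply/funext => N; rewrite /= SE.
Qed.

End Peano.

End LinearODE.

(** * The matrix exponential as a one-parameter group *)

Section Exponential.
Variable R : realType.
Variable n : nat.
Local Notation C := R[i].
Implicit Types X : 'M[C]_n.

Lemma exprZmx (c : C) X k : (c *: X) ^+ k = c ^+ k *: X ^+ k.
Proof.
elim: k => [|k IH]; first by rewrite !expr0 scale1r.
by rewrite !exprS IH -!mulmxE -scalemxAl -scalemxAr scalerA.
Qed.

Definition expm_term X k (t : R) : 'M[C]_n := (t ^+ k / k`!%:R)%:C%C *: X ^+ k.

Lemma expm_partialE X N t :
  expm_partial (t%:C%C *: X) N = \sum_(k < N) expm_term X k t.
Proof.
apply: eq_bigr => k _; rewrite exprZmx scalerA /expm_term; congr (_ *: _).
by rewrite rmorphM rmorphXn mulrC fmorphV rmorph_nat.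
Qed.

Lemma expm_term_der X k t :
  mder (expm_term X k.+1) t (expm_term X k t *m X).
Proof.
have D : is_derive t 1 (fun s : R => s ^+ k.+1 / k.+1`!%:R) (t ^+ k / k`!%:R).
  have -> : (fun s : R => s ^+ k.+1 / k.+1`!%:R) =
      (k.+1`!%:R^-1 : R) *: ((id : R -> R) ^+ k.+1).
    by apply/funext => s; rewrite !fctE mulrC.
  apply: is_derive_eq; rewrite /GRing.scale /= mulr1 -mulr_natl factS natrM.
  by field; rewrite nat1r !pnatr_eq0 -lt0n fact_gt0.
apply: mder_eq (mderZ (cder_real D) (mder_cst (X ^+ k.+1) t)) _ _ => //.
by rewrite scaler0 addr0 /cst /expm_term exprSr -mulmxE -scalemxAl.
Qed.

Lemma expm_term0 X t : expm_term X 0 t = 1%:M.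
Proof. by rewrite /expm_term !expr0 fact0 divr1 scale1r. Qed.

Lemma expm_term_at0 X k : expm_term X k.+1 0 = 0.
Proof. by rewrite /expm_term expr0n mul0r scale0r. Qed.

Lemma expmE X t :
  expm (t%:C%C *: X) = mxlim (fun N => \sum_(k < N) expm_term X k t).
Proof.
change (expm (t%:C%C *: X)) with (mxlim (expm_partial (t%:C%C *: X))).
have -> : expm_partial (t%:C%C *: X) = fun N => \sum_(k < N) expm_term X k t.
  by apply/funext => N; exact: expm_partialE.
reflexivity.
Qed.

Lemma expm_der X t :
  mder (fun t => expm (t%:C%C *: X)) t (expm (t%:C%C *: X) *m X).
Proof.
have cX s : mcont (fun _ : R => X) s by exact: mcvg_cst.
apply: mder_eq (peano_der cX (expm_term0 X) (expm_term_der X)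
  (expm_term_at0 X) t) _ _; last by rewrite expmE.
by move=> s; rewrite expmE.
Qed.

Lemma expm0 X : expm (0%:C%C *: X) = 1%:M.
Proof.
by rewrite expmE (peano_init (expm_term0 X) (expm_term_at0 X)).
Qed.

(** Transposition turns the equation E' = E X for [X^T] into E' = X E for [X], without first showing
    that X commutes with its exponential. *)
Lemma expm_tr X t : (expm (t%:C%C *: X))^T = expm (t%:C%C *: X^T).
Proof.
have E k : expm_term X^T k t = (expm_term X k t)^T.
  rewrite /expm_term linearZ /=; congr (_ *: _).
  elim: k => [|k IH]; first by rewrite !expr0 [RHS]trmx1.
  by rewrite exprSr exprS -!mulmxE trmx_mul IH.
have ES N : \sum_(k < N) expm_term X^T k t = (\sum_(k < N) expm_term X k t)^T.
  by rewrite linear_sum; apply: eq_bigr.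
rewrite !expmE; apply/matrixP => i j; rewrite [LHS]mxE [LHS]mxE [RHS]mxE.
by congr (limn _ +i* limn _)%C; apply/funext => N; rewrite ES mxE.
Qed.

Lemma expm_derl X t :
  mder (fun t => expm (t%:C%C *: X)) t (X *m expm (t%:C%C *: X)).
Proof.
apply: mder_eq (mder_tr (expm_der X^T t)) _ _.
  by move=> s; rewrite -expm_tr trmxK.
by rewrite trmx_mul -expm_tr !trmxK.
Qed.

Lemma expm_derN X t :
  mder (fun t => expm ((- t)%:C%C *: X)) t (- (X *m expm ((- t)%:C%C *: X))).
Proof.
have d : is_derive t 1 -%R (- (1 : R)) by exact: is_deriveNid.
apply: mder_eq (mder_comp (expm_derl X (- t)) d) _ _ => //.
by rewrite rmorphN rmorph1 scaleN1r.
Qed.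

Lemma mder0_cstT m p (f : R -> 'M[C]_(m, p)) :
  (forall t, mder f t 0) -> forall s t, f s = f t.
Proof.
move=> H s t; apply: (@mder0_cst R m p f (Num.min s t - 1)) => //;
  by have [] := leP s t; lra.
Qed.

Lemma expmD X s t :
  expm ((s + t)%:C%C *: X) = expm (t%:C%C *: X) *m expm (s%:C%C *: X).
Proof.
pose E u := expm (u%:C%C *: X).
have E0 : E 0 = 1%:M by exact: expm0.
(* The derivative in w of E (w + v) E (- w) vanishes: the first factor is differentiated in the form
   E X, the second in the form X E, and the two terms cancel. *)
have key u v : E (u + v) *m E (- u) = E v.
  pose f w := E (w + v) *m E (- w).
  have -> : E v = f 0 by rewrite /f oppr0 E0 mulmx1 add0r.
  apply: (@mder0_cstT n n f) => w.
  have d : is_derive w 1 (shift v) (1 : R) by exact: is_derive_shift.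
  have D := @mder_comp R n n E (shift v) w 1 _ (expm_der X (w + v)) d.
  apply: mder_eq (mderM D (expm_derN X w)) _ _ => //.
  by rewrite rmorph1 scale1r mulmxN mulmxA subrr.
rewrite -/(E _) -/(E _) -/(E _); move: E E0 key => E E0 key.
have inv u : E (- u) *m E u = 1%:M.
  by have := key (- u) 0; rewrite addr0 opprK E0.
by rewrite -(key s t) -mulmxA inv mulmx1.
Qed.

End Exponential.

(** * Existence, invertibility and uniqueness for linear equations *)

Section FundamentalSolution.
Variable R : realType.
Local Notation C := R[i].

Lemma mx_primitive n (B : R -> 'M[C]_n) : (forall t, mcont B t) ->
  exists Z : R -> 'M[C]_n, Z 0 = 0 /\ forall t, mder Z t (B t).
Proof.
move=> cB.
have /choice[F HF] : forall ij : 'I_n * 'I_n, exists F : R -> R, F 0 = 0 /\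
    forall t : R, is_derive t 1 F (complex.Re (B t ij.1 ij.2)).
  by move=> ij; apply: primitive => t; have [] := cB t ij.1 ij.2.
have /choice[G HG] : forall ij : 'I_n * 'I_n, exists F : R -> R, F 0 = 0 /\
    forall t : R, is_derive t 1 F (complex.Im (B t ij.1 ij.2)).
  by move=> ij; apply: primitive => t; have [] := cB t ij.1 ij.2.
exists (fun t => \matrix_(i, j) (F (i, j) t +i* G (i, j) t)%C); split.
  by apply/matrixP => i j; rewrite !mxE (HF (i, j)).1 (HG (i, j)).1.
move=> t i j; split.
  rewrite (_ : (fun s => _) = F (i, j)); first exact: ((HF (i, j)).2 t).
  by apply/funext => s; rewrite mxE.
rewrite (_ : (fun s => _) = G (i, j)); first exact: ((HG (i, j)).2 t).
by apply/funext => s; rewrite mxE.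
Qed.

Lemma linear_ode_line n (A : R -> 'M[C]_n) : (forall t, mcont A t) ->
  exists h : R -> 'M[C]_n, h 0 = 1%:M /\ forall t, mder h t (h t *m A t).
Proof.
move=> cA.
have /choice[nxt Hn] : forall Z : R -> 'M[C]_n, exists Z' : R -> 'M[C]_n,
    (forall t, mcont Z t) -> Z' 0 = 0 /\ forall t, mder Z' t (Z t *m A t).
  (* For a discontinuous Z the value Z is a placeholder that makes [nxt] total; the iterates
     starting from the identity are all continuous. *)
  move=> Z; have [cZ|ncZ] := pselect (forall t, mcont Z t); last by exists Z.
  have [|Z' HZ'] := @mx_primitive n (fun t => Z t *m A t); last by exists Z'.
  by move=> t; apply: mcvgM; [exact: cZ|exact: cA].
pose Z k := iter k nxt (cst (1%:M : 'M[C]_n)).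
have cZ k : forall t, mcont (Z k) t.
  elim: k => [|k IH] t; first exact: mcvg_cst.
  by have [_ h] := Hn _ IH; exact: mder_cont (h t).
have ZS k t : mder (Z k.+1) t (Z k t *m A t) by exact: (Hn _ (cZ k)).2.
have ZS0 k : Z k.+1 0 = 0 by exact: (Hn _ (cZ k)).1.
have Z0 t : Z 0%N t = 1%:M by [].
exists (fun t => mxlim (fun N => \sum_(k < N) Z k t)); split.
  exact: peano_init.
exact: peano_der.
Qed.

(* The substitution y = a + e^s carries the half line onto the whole line. *)
Lemma linear_ode n (a : R) (A : R -> 'M[C]_n) : (forall y, a < y -> mcont A y) ->
  exists h : R -> 'M[C]_n, h (a + 1) = 1%:M /\
    forall y, a < y -> mder h y (h y *m A y).
Proof.
move=> cA; pose B s := (expR s)%:C%C *: A (a + expR s).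
have cB s : mcont B s.
  apply: mcvgZ.
    exact: (cder_cvg (cder_real (is_derive_expR s))).
  have cE : (fun s => a + expR s) @ s --> a + expR s.
    by apply: cvgD; [exact: cvg_cst|exact: continuous_expR].
  have lt : a < a + expR s by rewrite ltrDl expR_gt0.
  move=> i j; have [c1 c2] := cA _ lt i j; split.
    exact: (cvg_comp _ _ cE c1).
  exact: (cvg_comp _ _ cE c2).
have [k [k0 Hk]] := linear_ode_line cB.
(* The initial point s = 0 corresponds to y = a + 1, whence the base point used throughout. *)
exists (fun y => k (ln (y - a))); split; first by rewrite addrAC subrr add0r ln1.
move=> y ay; have ya : 0 < y - a by rewrite subr_gt0.
have d : is_derive y 1 (fun y => ln (y - a)) (y - a)^-1.
  have d1 : is_derive y 1 (fun y => y - a) (1 : R) by exact: is_derive_shift.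
  have := @is_derive1_comp R (@ln R) (fun y => y - a) y _ _ (is_derive1_ln ya) d1.
  by rewrite mulr1.
apply: mder_eq (mder_comp (Hk _) d) _ _ => //.
rewrite /B lnK ?posrE // [a + _]addrC subrK -scalemxAr scalerA -rmorphM /= mulVf ?scale1r //.
by rewrite gt_eqF.
Qed.

Lemma linear_ode_l n (a : R) (A : R -> 'M[C]_n) : (forall y, a < y -> mcont A y) ->
  exists h : R -> 'M[C]_n, h (a + 1) = 1%:M /\
    forall y, a < y -> mder h y (A y *m h y).
Proof.
move=> cA; have [|h [h1 Hh]] := @linear_ode n a (fun y => (A y)^T).
  by move=> y ay; apply: mcvg_tr; exact: cA.
exists (fun y => (h y)^T); split; first by rewrite h1 trmx1.
move=> y ay; apply: mder_eq (mder_tr (Hh y ay)) _ _ => //.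
by rewrite trmx_mul trmxK.
Qed.

(** The inverse is itself a solution: if g' = - A g and g (a + 1) = 1, then h g is constant. *)
Lemma linear_ode_unit n (a : R) (A h : R -> 'M[C]_n) :
  (forall y, a < y -> mcont A y) -> h (a + 1) = 1%:M ->
  (forall y, a < y -> mder h y (h y *m A y)) ->
  forall y, a < y -> h y \in unitmx.
Proof.
move=> cA h1 Hh.
have [|g [g1 Hg]] := @linear_ode_l n a (fun y => - A y).
  by move=> y ay; apply: mcvgN; exact: cA.
have a1 : a < a + 1 by rewrite ltrDl.
move=> y ay; suff E : h y *m g y = 1%:M by case: (mulmx1_unit E).
rewrite (@mder0_cst R n n (fun y => h y *m g y) a _ y (a + 1)) //.
  by rewrite h1 g1 mulmx1.
move=> t at_; apply: mder_eq (mderM (Hh t at_) (Hg t at_)) _ _ => //.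
by rewrite mulNmx mulmxN mulmxA subrr.
Qed.

(** For g' = - g X and k' = - Y k the product g Z k has derivative zero, hence vanishes, and g, k
    are invertible. No Gronwall estimate is involved. *)
Lemma linear_ode_zero n (a : R) (X Y Z : R -> 'M[C]_n) :
  (forall y, a < y -> mcont X y) -> (forall y, a < y -> mcont Y y) ->
  Z (a + 1) = 0 -> (forall y, a < y -> mder Z y (X y *m Z y + Z y *m Y y)) ->
  forall y, a < y -> Z y = 0.
Proof.
move=> cX cY Z1 HZ.
have cNX y : a < y -> mcont (fun y => - X y) y.
  by move=> ay; apply: mcvgN; exact: cX.
have cNY y : a < y -> mcont (fun y => - Y y) y.
  by move=> ay; apply: mcvgN; exact: cY.
have [g [g1 Hg]] := linear_ode cNX.
have [k [k1 Hk]] := linear_ode_l cNY.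
move=> y ay.
have gU := linear_ode_unit cNX g1 Hg ay.
have kU : k y \in unitmx.
  rewrite -unitmx_tr.
  apply: (@linear_ode_unit n a (fun y => (- Y y)^T) (fun y => (k y)^T)) => //.
  - by move=> t at_; apply: mcvg_tr; exact: cNY.
  - by rewrite k1 trmx1.
  - move=> t at_; apply: mder_eq (mder_tr (Hk t at_)) _ _ => //.
    by rewrite trmx_mul.
have a1 : a < a + 1 by rewrite ltrDl.
have E : g y *m Z y *m k y = 0.
  rewrite (@mder0_cst R n n (fun y => g y *m Z y *m k y) a _ y (a + 1)) //.
    by rewrite Z1 mulmx0 mul0mx.
  move=> t at_.
  apply: mder_eq (mderM (mderM (Hg t at_) (HZ t at_)) (Hk t at_)) _ _ => //.
  rewrite mulmxDr !mulmxA mulmxN !mulNmx mulmxN addrA addNr add0r.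
  by rewrite mulNmx subrr.
by rewrite -(mulKmx gU (Z y)) -(mulmxK kU (g y *m Z y)) E mul0mx mulmx0.
Qed.

End FundamentalSolution.

(** * Complex conjugation, rational subspaces and bilinear forms *)

Section Conjugation.
Variable R : realType.
Local Notation C := R[i].

Lemma conjmM m p q (A : 'M[C]_(m, p)) (B : 'M[C]_(p, q)) :
  conjm (A *m B) = conjm A *m conjm B.
Proof. exact: map_mxM. Qed.

Lemma conjmK m p (A : 'M[C]_(m, p)) : conjm (conjm A) = A.
Proof. by apply/matrixP => i j; rewrite !mxE conjCK. Qed.

Lemma conjm_tr m p (A : 'M[C]_(m, p)) : conjm A^T = (conjm A)^T.
Proof. by apply/matrixP => i j; rewrite !mxE. Qed.

Lemma conjmZ m p c (A : 'M[C]_(m, p)) : conjm (c *: A) = c^* *: conjm A.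
Proof. exact: map_mxZ. Qed.

Lemma conjm0 m p : conjm (0 : 'M[C]_(m, p)) = 0.
Proof. exact: map_mx0. Qed.

Lemma conjm_sub m p q (A : 'M[C]_(m, q)) (B : 'M[C]_(p, q)) :
  (conjm A <= conjm B)%MS = (A <= B)%MS.
Proof. exact: map_submx. Qed.

Lemma conjm_rational m p (A : 'M[C]_(m, p)) : rational_mx A -> conjm A = A.
Proof.
case=> A0 ->; apply/matrixP => i j; rewrite !mxE.
exact: (fmorph_rat (@Num.conj C)).
Qed.

Lemma conjm_rational_subspace n (U : 'M[C]_n) :
  rational_subspace U -> (conjm U :=: U)%MS.
Proof.
case=> A0 /eqmxP UA; apply/eqmxP.
have cA : conjm (map_mx ratr A0 : 'M[C]_n) = map_mx ratr A0.
  by apply: conjm_rational; exists A0.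
have cU : (conjm U == map_mx ratr A0)%MS.
  by rewrite -cA !conjm_sub; apply/eqmxP.
by rewrite !UA; exact: cU.
Qed.

Lemma bil_conj n (B : 'M[C]_n) x y : conjm B = B ->
  bil B (conjm x) (conjm y) = (bil B x y)^*.
Proof.
by move=> cB; rewrite /bil -conjm_tr -{1}cB -!conjmM mxE.
Qed.

Lemma bil_suml n (B : 'M[C]_n) (J : finType) (P : pred J) (f : J -> 'rV[C]_n) y :
  bil B (\sum_(j | P j) f j) y = \sum_(j | P j) bil B (f j) y.
Proof. by rewrite /bil !mulmx_suml summxE. Qed.

Lemma bil_sumr n (B : 'M[C]_n) (J : finType) (P : pred J) (f : J -> 'rV[C]_n) x :
  bil B x (\sum_(j | P j) f j) = \sum_(j | P j) bil B x (f j).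
Proof. by rewrite /bil linear_sum mulmx_sumr summxE. Qed.

Lemma bilZl n (B : 'M[C]_n) c x y : bil B (c *: x) y = c * bil B x y.
Proof. by rewrite /bil -!scalemxAl mxE. Qed.

Lemma bilZr n (B : 'M[C]_n) c x y : bil B x (c *: y) = c * bil B x y.
Proof. by rewrite /bil linearZ /= -scalemxAr mxE. Qed.

Lemma bil_tr n (B : 'M[C]_n) x y : bil B x y = bil B^T y x.
Proof.
rewrite /bil (_ : (x *m B *m y^T) 0 0 = (x *m B *m y^T)^T 0 0); last by rewrite [RHS]mxE.
by rewrite !trmx_mul trmxK mulmxA.
Qed.

End Conjugation.

(* Row form of the conditions cutting out Lie(G_C) and Lie(H). *)
Definition infinitesimal_GC (R : realType) n (W Q : int -> 'M[R[i]]_n)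
    (X : 'M[R[i]]_n) : Prop :=
  (forall k, (W k *m X^T <= W k)%MS) /\
  (forall k x y, (x <= W k)%MS -> (y <= W k)%MS ->
     bil (Q k) (x *m X^T) y + bil (Q k) x (y *m X^T) = 0).

Definition infinitesimal_H (R : realType) n (W Q : int -> 'M[R[i]]_n)
    (X : 'M[R[i]]_n) : Prop :=
  infinitesimal_GC W Q X /\
  (forall k, (W k *m (conjm X - X)^T <= W (k - 2)%R)%MS).

(** * Block calculus on the Deligne bigrading and the action of L *)

Section Bigrading.
Variables (R : realType) (n : nat).
Local Notation C := R[i].
Variables (W Q Fo : int -> 'M[C]_n) (N : nat) (I : int -> int -> 'M[C]_n).
Hypothesis gfQ : graded_forms W Q.
Hypothesis polF : forall (k p : int) x y, (x <= Fo p :&: W k)%MS ->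
  (y <= Fo (k - p + 1)%R :&: W k)%MS -> bil (Q k) x y = 0.
Hypothesis bigI : is_split_Deligne_bigrading Fo W N I.

Local Notation ix := ('I_(2 * N + 1) * 'I_(2 * N + 1))%type.
Local Notation J := (fun a : ix => I (bidx a).1 (bidx a).2).

(* Locked because unification would otherwise unfold proj_mx to a matrix
   product when rewriting with mulmxA or trmx_mul. *)
Definition bigr_proj (a : ix) : 'M[C]_n :=
  locked (proj_mx (J a) (\sum_(c | c != a) J c)%MS).
Local Notation p := bigr_proj.

Definition bigr_sum (S : pred ix) : 'M[C]_n := (\sum_(a | S a) J a)%MS.

Definition bigr_swap (a : ix) : ix := (a.2, a.1).

Definition bigr_wt (a : ix) : int := (bidx a).1 + (bidx a).2.

Lemma bigr_swapK : involutive bigr_swap.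
Proof. by case. Qed.

Lemma bigr_cap (a : ix) : (J a :&: (\sum_(c | c != a) J c) = 0)%MS.
Proof.
case: bigI => _ [/mxdirect_sumsP H _] _ _ _.
exact: H.
Qed.

Lemma bigr_proj_sub a m (A : 'M[C]_(m, n)) : (A *m p a <= J a)%MS.
Proof. by rewrite /bigr_proj -lock; exact: proj_mx_sub. Qed.

Lemma piIE a : piI I a = (p a)^T.
Proof. by rewrite /bigr_proj -lock. Qed.

Lemma bigr_proj_sub1 a : (p a <= J a)%MS.
Proof. by have := bigr_proj_sub a 1%:M; rewrite mul1mx. Qed.

Lemma bigr_proj_id a m (A : 'M[C]_(m, n)) : (A <= J a)%MS -> A *m p a = A.
Proof. by rewrite /bigr_proj -lock; exact: proj_mx_id (bigr_cap a). Qed.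

Lemma bigr_proj_0 a c m (A : 'M[C]_(m, n)) : (A <= J a)%MS -> c != a -> A *m p c = 0.
Proof.
move=> Aa ca; rewrite /bigr_proj -lock; apply: proj_mx_0 (bigr_cap c) _; apply: submx_trans Aa _.
by apply: (sumsmx_sup a) => //; rewrite eq_sym.
Qed.

Lemma bigr_proj_mul a c : p a *m p c = if c == a then p a else 0.
Proof.
case: eqVneq => [->|ca]; first exact: bigr_proj_id (bigr_proj_sub1 a).
exact: bigr_proj_0 (bigr_proj_sub1 a) ca.
Qed.

Lemma bigr_proj_sum : \sum_a p a = 1%:M.
Proof.
case: bigI => _ [_ /eqmxP full] _ _ _.
have /sub_sumsmxP[u E] : (1%:M <= \sum_a J a)%MS by rewrite full.
rewrite -[LHS]mul1mx E mulmx_suml; apply: eq_bigr => a _.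
rewrite mulmx_sumr (bigD1 a) //= bigr_proj_id ?submxMl // big1 ?addr0 // => c ca.
by apply: bigr_proj_0 ca; exact: submxMl.
Qed.

Lemma bigr_decomp m (A : 'M[C]_(m, n)) : A = \sum_a A *m p a.
Proof. by rewrite -mulmx_sumr bigr_proj_sum mulmx1. Qed.

Lemma bigr_sumP (S : pred ix) m (A : 'M[C]_(m, n)) :
  (A <= bigr_sum S)%MS <-> forall a, ~~ S a -> A *m p a = 0.
Proof.
split=> [/sub_sumsmxP[u ->] a Sa|H].
  rewrite mulmx_suml big1 // => c Sc.
  apply: (@bigr_proj_0 c); first exact: submxMl.
  by apply: contra Sa => /eqP ->.
rewrite (bigr_decomp A); apply: summx_sub => a _.
have [Sa|Sa] := boolP (S a); last by rewrite H // sub0mx.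
by apply: (sumsmx_sup a) => //; exact: bigr_proj_sub.
Qed.

(** Inclusions between sums of I^{p,q} become vanishing of blocks, and on blocks L acts by scalars.
    Rows act on the left, so [a] is the source and [c] the target. *)
Lemma bigr_sum_mapP (S T : pred ix) (Y : 'M[C]_n) :
  (bigr_sum S *m Y <= bigr_sum T)%MS <->
  forall a c, S a -> ~~ T c -> p a *m Y *m p c = 0.
Proof.
split=> [H a c Sa Tc|H].
  apply: (bigr_sumP T (p a *m Y)).1 Tc; apply: submx_trans H; apply: submxMr.
  by apply: (sumsmx_sup a) => //; exact: bigr_proj_sub1.
apply/bigr_sumP => c Tc; rewrite (bigr_decomp (bigr_sum S)).
rewrite !mulmx_suml big1 // => a _.
have [Sa|Sa] := boolP (S a).
  have -> : bigr_sum S *m p a *m Y *m p c = bigr_sum S *m (p a *m Y *m p c).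
    by rewrite !mulmxA.
  by rewrite H ?mulmx0.
by rewrite ((bigr_sumP S _).1 (submx_refl _) a Sa) !mul0mx.
Qed.

Lemma bigr_W k : (W k :=: bigr_sum (fun a => (bigr_wt a <= k)%R))%MS.
Proof. by case: bigI => _ _ _ H _; apply/eqmxP. Qed.

Lemma bigr_F q : (Fo q :=: bigr_sum (fun a => (q <= (bidx a).1)%R))%MS.
Proof. by case: bigI => _ _ H _ _; apply/eqmxP. Qed.

Lemma W_mapP k l (Y : 'M[C]_n) : (W k *m Y <= W l)%MS <->
  forall a c, bigr_wt a <= k -> l < bigr_wt c -> p a *m Y *m p c = 0.
Proof.
rewrite bigr_W (eqmxMr _ (bigr_W k)); split => [/bigr_sum_mapP H a c ak lc|H].
  by apply: H => //; rewrite -ltNge.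
by apply/bigr_sum_mapP => a c ak; rewrite -ltNge; exact: H.
Qed.

Lemma bigr_conj_sub a m (A : 'M[C]_(m, n)) :
  (A <= J a)%MS -> (conjm A <= J (bigr_swap a))%MS.
Proof.
case: bigI => _ _ _ _ H Aa.
by rewrite -(eqmxP (H _ _)) conjm_sub.
Qed.

(** This is where splitting over R enters: conjugation permutes the summands exactly, hence also the
    projections along them. *)
Lemma bigr_proj_conj a : conjm (p a) = p (bigr_swap a).
Proof.
rewrite (bigr_decomp (conjm (p a))) (bigD1 (bigr_swap a)) //=.
have s : (conjm (p a) <= J (bigr_swap a))%MS.
  exact: bigr_conj_sub (bigr_proj_sub1 a).
rewrite [X in _ + X]big1 ?addr0 => [|c ca]; last exact: bigr_proj_0 s ca.
rewrite bigr_proj_id // -[LHS]mul1mx -bigr_proj_sum mulmx_suml.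
rewrite (bigD1 (bigr_swap a)) //= big1 ?addr0 => [|c ca].
  rewrite -[X in X *m _]conjmK -conjmM bigr_proj_id ?conjmK //.
  by have := bigr_conj_sub (bigr_proj_sub1 (bigr_swap a)); rewrite bigr_swapK.
rewrite -[X in X *m _]conjmK -conjmM (@bigr_proj_0 (bigr_swap c)) ?conjm0 //.
  exact: bigr_conj_sub (bigr_proj_sub1 c).
by apply: contra ca => /eqP ->; rewrite bigr_swapK.
Qed.

Lemma Lop_block X a c : p a *m (Lop N I X)^T *m p c =
  Lcoef R ((bidx c).1 - (bidx a).1) ((bidx c).2 - (bidx a).2) *: (p a *m X^T *m p c).
Proof.
rewrite /Lop linear_sum /= mulmx_sumr mulmx_suml (bigD1 a) //=.
rewrite [X in _ + X]big1 ?addr0 => [|d da]; last first.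
  rewrite linear_sum mulmx_sumr mulmx_suml big1 // => e _.
  rewrite linearZ /= -scalemxAr -scalemxAl !piIE !trmx_mul !trmxK !mulmxA.
  by rewrite bigr_proj_mul (negbTE da) !mul0mx scaler0.
rewrite linear_sum mulmx_sumr mulmx_suml (bigD1 c) //=.
rewrite [X in _ + X]big1 ?addr0 => [|d dc]; last first.
  rewrite linearZ /= -scalemxAr -scalemxAl !piIE !trmx_mul !trmxK -!mulmxA.
  by rewrite bigr_proj_mul eq_sym (negbTE dc) !mulmx0 scaler0.
rewrite linearZ /= -scalemxAr -scalemxAl !piIE !trmx_mul !trmxK !mulmxA.
by rewrite bigr_proj_mul eqxx -!mulmxA bigr_proj_mul eqxx.
Qed.

(** On every block with r < 0, in eta_- and Lambda alike, L is multiplication by -i and cancels i;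
    the remaining blocks preserve each F^p. *)
Lemma Lop_plus_i_F X q : (Fo q *m ('i *: X + Lop N I X)^T <= Fo q)%MS.
Proof.
rewrite bigr_F (eqmxMr _ (bigr_F q)); apply/bigr_sum_mapP => a c qa.
rewrite -ltNge => cq.
rewrite linearD linearZ /= mulmxDr mulmxDl Lop_block -scalemxAr -scalemxAl -scalerDl.
have neg : (bidx c).1 - (bidx a).1 < 0 by lia.
by rewrite /Lcoef leNgt neg /= subrr scale0r.
Qed.

Lemma bigr_W_sub a k m (A : 'M[C]_(m, n)) :
  (A <= J a)%MS -> bigr_wt a <= k -> (A <= W k)%MS.
Proof.
move=> Aa ak; rewrite bigr_W; apply: submx_trans Aa _; exact: (sumsmx_sup a).
Qed.

Lemma bigr_F_sub a q m (A : 'M[C]_(m, n)) :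
  (A <= J a)%MS -> q <= (bidx a).1 -> (A <= Fo q)%MS.
Proof.
move=> Aa ak; rewrite bigr_F; apply: submx_trans Aa _; exact: (sumsmx_sup a).
Qed.

Lemma bil_W_radical k x y : (x <= W k)%MS -> (y <= W k)%MS ->
  (x <= W (k - 1)%R)%MS || (y <= W (k - 1)%R)%MS -> bil (Q k) x y = 0.
Proof.
have [_ par rad _] := gfQ k.
move=> xk yk /orP[x1|y1]; first exact: rad.
by rewrite bil_tr par /bil -scalemxAr -scalemxAl mxE -/(bil (Q k) y x) rad ?mulr0.
Qed.

(** If c has weight below k, u lies in the radical. Otherwise compare the sum of the first indices
    with k: a larger sum is excluded by the first Riemann bilinear relation, a smaller one becomes
    larger after conjugation, and equality forces c to be the swap of b. *)
Lemma bil_bigr_orth k c b u v : (u <= J c)%MS -> (v <= J b)%MS ->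
  bigr_wt c <= k -> bigr_wt b = k -> c != bigr_swap b -> bil (Q k) u v = 0.
Proof.
move=> uc vb ck bk cb.
have uW := bigr_W_sub uc ck.
have vW : (v <= W k)%MS by apply: bigr_W_sub vb _; rewrite bk.
have [ck'|] := ltP (bigr_wt c) k.
  apply: bil_W_radical => //; apply/orP; left; apply: bigr_W_sub uc _.
  by rewrite -ltzD1 subrK.
move=> kc; have {ck kc} ck : bigr_wt c = k by apply/le_anti/andP.
have gt (c' b' : ix) u' v' : (u' <= J c')%MS -> (v' <= J b')%MS ->
    bigr_wt c' = k -> bigr_wt b' = k ->
    k < (bidx c').1 + (bidx b').1 -> bil (Q k) u' v' = 0.
  move=> uc' vb' ck' bk' lt; apply: (@polF k (bidx c').1).
    by rewrite sub_capmx (bigr_F_sub uc') // (bigr_W_sub uc') // ck'.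
  rewrite sub_capmx (bigr_W_sub vb') ?bk' // andbT (bigr_F_sub vb') //.
  by move: lt; lia.
have [lt|] := ltP k ((bidx c).1 + (bidx b).1); first exact: gt lt.
rewrite le_eqVlt => /predU1P[e|lt].
  case/eqP: cb; case: c b ck bk e {uc vb uW vW} => [c1 c2] [b1 b2].
  rewrite /bigr_wt /bidx /bigr_swap /= => ck bk e.
  by congr (_, _); apply: val_inj => /=; lia.
have [ratQ _ _ _] := gfQ k.
rewrite -[LHS]conjCK -bil_conj ?(conjm_rational ratQ) //.
rewrite (gt (bigr_swap c) (bigr_swap b)) ?conjC0 //.
- exact: bigr_conj_sub.
- exact: bigr_conj_sub.
- by rewrite -ck /bigr_wt /= addrC.
- by rewrite -bk /bigr_wt /= addrC.
- by move: ck bk lt; rewrite /bigr_wt /=; lia.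
Qed.

(** Only the component of X u at the swap of b pairs with v. Its type is (r, -r) with r = k - a1 -
    b1, which is symmetric in a and b, so the same scalar factors out of both terms of the
    invariance identity. *)
Lemma Lop_bil X k a b u v : infinitesimal_GC W Q X ->
  (u <= J a)%MS -> (v <= J b)%MS -> bigr_wt a = k -> bigr_wt b = k ->
  bil (Q k) (u *m (Lop N I X)^T) v =
  Lcoef R (k - (bidx a).1 - (bidx b).1) ((bidx a).1 + (bidx b).1 - k) *
    bil (Q k) (u *m X^T) v.
Proof.
move=> [XW _] ua vb ak bk.
have Xsub : (u *m X^T <= W k)%MS.
  by apply: submx_trans (submxMr _ _) (XW k); apply: bigr_W_sub ua _; rewrite ak.
rewrite (bigr_decomp (u *m (Lop N I X)^T)) [X in _ * bil _ X _](bigr_decomp (u *m X^T)).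
rewrite !bil_suml mulr_sumr; apply: eq_bigr => c _.
have -> : u *m (Lop N I X)^T *m p c =
    Lcoef R ((bidx c).1 - (bidx a).1) ((bidx c).2 - (bidx a).2) *: (u *m X^T *m p c).
  have uE (Y : 'M[C]_n) : u *m Y *m p c = u *m (p a *m Y *m p c).
    by rewrite !mulmxA (bigr_proj_id ua).
  by rewrite !uE Lop_block -scalemxAr.
rewrite bilZl.
have [cb|cb] := eqVneq c (bigr_swap b).
  congr (Lcoef R _ _ * _); rewrite cb;
  by move: ak bk; rewrite /bigr_wt /=; lia.
suff -> : bil (Q k) (u *m X^T *m p c) v = 0 by rewrite !mulr0.
have [ck|ck] := leP (bigr_wt c) k.
  by apply: bil_bigr_orth vb ck bk cb; exact: bigr_proj_sub.
rewrite bigr_W in Xsub.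
by rewrite ((bigr_sumP _ _).1 Xsub c) -?ltNge // /bil !mul0mx mxE.
Qed.

Lemma bilN_parity k x y : bil (Q k) x y = (-1) ^ k * bil (Q k) y x.
Proof.
have [_ par _ _] := gfQ k.
by rewrite bil_tr par /bil -scalemxAr -scalemxAl mxE.
Qed.

Lemma Lop_infinitesimal_GC X : infinitesimal_GC W Q X ->
  infinitesimal_GC W Q (Lop N I X).
Proof.
move=> gX; have [XW XQ] := gX.
have LW k : (W k *m (Lop N I X)^T <= W k)%MS.
  apply/W_mapP => a c ak kc; rewrite Lop_block.
  by have /W_mapP -> := XW k; rewrite ?scaler0.
split => // k x y xk yk.
have sub m (A : 'M[C]_(m, n)) l :
    (A <= W l)%MS -> (A *m (Lop N I X)^T <= W l)%MS.
  by move=> Al; apply: submx_trans (submxMr _ Al) (LW l).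
have dec (z : 'rV[C]_n) : (z <= W k)%MS ->
    z = \sum_(a | bigr_wt a <= k) z *m p a.
  rewrite bigr_W => zk; rewrite {1}(bigr_decomp z) [RHS]big_mkcond /=.
  by apply: eq_bigr => a _; case: ifPn => // /((bigr_sumP _ _).1 zk).
rewrite {1 2}(dec x xk) {1 2}(dec y yk) !mulmx_suml !bil_suml -big_split /=.
apply: big1 => a ak; rewrite !bil_sumr -big_split /=; apply: big1 => b bk.
have ua := bigr_proj_sub a x; have vb := bigr_proj_sub b y.
move: (x *m p a) (y *m p b) ua vb => u v ua vb.
have uW := bigr_W_sub ua ak; have vW := bigr_W_sub vb bk.
have [ak'|ka] := ltP (bigr_wt a) k.
  have u1 : (u <= W (k - 1)%R)%MS.
    by apply: bigr_W_sub ua _; rewrite -ltzD1 subrK.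
  rewrite (bil_W_radical (sub _ _ _ uW) vW) ?(sub _ _ _ u1) ?u1 ?orbT // add0r.
  by rewrite (bil_W_radical uW (sub _ _ _ vW)) ?(sub _ _ _ u1) ?u1 ?orbT.
have [bk'|kb] := ltP (bigr_wt b) k.
  have v1 : (v <= W (k - 1)%R)%MS.
    by apply: bigr_W_sub vb _; rewrite -ltzD1 subrK.
  rewrite (bil_W_radical (sub _ _ _ uW) vW) ?(sub _ _ _ v1) ?v1 ?orbT // add0r.
  by rewrite (bil_W_radical uW (sub _ _ _ vW)) ?(sub _ _ _ v1) ?v1 ?orbT.
have {ak ka} ak : bigr_wt a = k by apply/le_anti/andP.
have {bk kb} bk : bigr_wt b = k by apply/le_anti/andP.
rewrite (Lop_bil gX ua vb ak bk) [bil _ u _]bilN_parity (Lop_bil gX vb ua bk ak).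
have -> : k - (bidx b).1 - (bidx a).1 = k - (bidx a).1 - (bidx b).1 by lia.
have -> : (bidx b).1 + (bidx a).1 - k = (bidx a).1 + (bidx b).1 - k by lia.
by rewrite mulrCA -bilN_parity -mulrDr XQ ?mulr0.
Qed.

(** When r + s is 0 or -1, r and s cannot both be negative: either r = s = 0, or exactly one is
    negative and the coefficients i and -i are exchanged. For two negative indices the identity
    fails. *)
Lemma Lcoef_conj (r s : int) : r + s = 0 \/ r + s = -1 ->
  (Lcoef R s r)^* = Lcoef R r s.
Proof.
rewrite /Lcoef => rs; have := @conjCi C; move: ('i : C) => ii cii.
have [r0|r0] := ltP r 0; have [s0|s0] := ltP s 0.
- by exfalso; lia.
- exact: cii.
- by have e : (- ii)^* = ii by [rewrite -cii conjCK]; exact: e.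
- exact: conjC0.
Qed.

Lemma Lop_infinitesimal_H X : infinitesimal_H W Q X ->
  infinitesimal_H W Q (Lop N I X).
Proof.
move=> [gX XR]; split; first exact: Lop_infinitesimal_GC.
have [XW _] := gX.
have conj_block (Y : 'M[C]_n) a c :
    p a *m (conjm Y)^T *m p c = conjm (p (bigr_swap a) *m Y^T *m p (bigr_swap c)).
  by rewrite !conjmM !bigr_proj_conj !bigr_swapK conjm_tr.
move=> k; apply/W_mapP => a c ak kc.
have XRac : p a *m (conjm X)^T *m p c = p a *m X^T *m p c.
  apply/eqP; rewrite -subr_eq0 -mulmxBl -mulmxBr -linearB /=.
  by have /W_mapP -> := XR k.
rewrite linearB /= mulmxBr mulmxBl conj_block !Lop_block conjmZ -conj_block XRac -scalerBl.
(* Blocks raising the weight vanish since X preserves W. The others satisfy k - 2 < wt c <= wt a <=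
   k, so the weight changes by 0 or -1. *)
have [lt|le] := ltP (bigr_wt a) (bigr_wt c).
  by have /W_mapP -> := XW (bigr_wt a); rewrite ?scaler0.
rewrite Lcoef_conj ?subrr ?scale0r //.
by move: ak kc le; rewrite /bigr_wt /bigr_swap /bidx /=; lia.
Qed.

End Bigrading.

(** * Passage between group conditions and their infinitesimal forms *)

Section Integration.
Variables (R : realType) (n : nat).
Local Notation C := R[i].

Lemma mder_eq0 m p (f : R -> 'M[C]_(m, p)) (t : R) D :
  mder f t D -> (forall s, f s = f t) -> D = 0.
Proof.
move=> fD H; apply: (mder_unique fD).
by apply: mder_eq (mder_cst (f t) t) _ _ => // s; rewrite H.
Qed.

Lemma bil_mx_eq0 (U M : 'M[C]_n) :
  (forall x y : 'rV[C]_n, (x <= U)%MS -> (y <= U)%MS -> (x *m M *m y^T) 0 0 = 0) ->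
  U *m M *m U^T = 0.
Proof.
move=> H; apply/matrixP => i j.
rewrite [RHS]mxE -(H (row i U) (row j U) (row_sub i U) (row_sub j U)).
by rewrite -row_mul [LHS]mxE [RHS]mxE; apply: eq_bigr => k _; rewrite !mxE.
Qed.

Variables (W Q : int -> 'M[C]_n).
Hypothesis filtW : rational_increasing_filtration W.

Let conjW k : (conjm (W k) :=: W k)%MS.
Proof. by apply: conjm_rational_subspace; case: filtW => _ _; exact. Qed.

Lemma infinitesimal_GCZ c X : infinitesimal_GC W Q X -> infinitesimal_GC W Q (c *: X).
Proof.
move=> [XW XQ]; split=> [k|k x y xk yk].
  by rewrite linearZ /= -scalemxAr; apply: scalemx_sub; exact: XW.
by rewrite linearZ /= -!scalemxAr bilZl bilZr -mulrDr XQ // mulr0.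
Qed.

Lemma infinitesimal_HN X : infinitesimal_H W Q X -> infinitesimal_H W Q (- X).
Proof.
move=> [gX XR]; split; first by rewrite -scaleN1r; exact: infinitesimal_GCZ.
move=> k; rewrite -scaleN1r conjmZ rmorphN1 -scalerBr linearZ /= -scalemxAr.
exact: scalemx_sub.
Qed.

(** Each defining condition of H is written as constancy in t of a matrix built from exp(tX), and
    differentiated at t = 0. *)
Lemma lieH_infinitesimal X : in_lieH W Q X -> infinitesimal_H W Q X.
Proof.
move=> HX; pose E t := expm (t%:C%C *: X).
have E0 : E 0 = 1%:M by exact: expm0.
have dE : mder E 0 X.
  by apply: mder_eq (expm_der X 0) _ _ => //; rewrite expm0 mul1mx.
have {}HX t : in_H W Q (E t) by exact: HX.
move: E E0 dE HX => E E0 dE HX.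
split; first split.
- move=> k; rewrite submxE; apply/eqP.
  apply: (mder_eq0 (mderMr (cokermx (W k)) (mderMl (W k) (mder_tr dE)))) => s.
  have Z t : W k *m (E t)^T *m cokermx (W k) = 0.
    apply/eqP; rewrite -submxE.
    by have [[[_ h _] _] _] := HX t; exact: h.
  by rewrite !Z.
- move=> k x y xk yk.
  have d := mderM (mderM (mderMl x (mder_tr dE)) (mder_cst (Q k) 0))
                  (mderMr y^T dE).
  have inv t : x *m (E t)^T *m Q k *m (E t *m y^T) = x *m Q k *m y^T.
    have [[[_ _ h] _] _] := HX t.
    apply/matrixP => i j; rewrite !ord1.
    by have := h k x y xk yk; rewrite /bil /app trmx_mul trmxK.
  have := mder_eq0 d; rewrite /cst => /(_ (fun s => etrans (inv s) (esym (inv 0)))).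
  rewrite E0 trmx1 mulmx1 mul1mx mulmx0 addr0 => /matrixP/(_ 0 0).
  by rewrite mxE [RHS]mxE /bil trmx_mul trmxK.
- move=> k; rewrite submxE; apply/eqP.
  apply: (mder_eq0 (mderMr (cokermx (W (k - 2)))
    (mderMl (W k) (mder_tr (mderB (mder_conjm dE) dE))))) => s.
  have Z t : W k *m (conjm (E t) - E t)^T *m cokermx (W (k - 2)) = 0.
    apply/eqP; rewrite -submxE; have [_ h] := HX t.
    apply/row_subP => i; rewrite row_mul.
    (* Applied to the conjugate of a row, the reality condition moves the conjugation from the
       vector onto [E t]. *)
    have xk : (conjm (row i (W k)) <= W k)%MS.
      by rewrite -(conjW k) conjm_sub row_sub.
    have := h k _ xk.
    by rewrite /app conjmM conjmK conjm_tr -mulmxBr -linearB.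
  by rewrite !Z.
Qed.

Variables (a : R) (A h : R -> 'M[C]_n).
Hypothesis contA : forall y, a < y -> mcont A y.
Hypothesis h1 : h (a + 1) = 1%:M.
Hypothesis Hh : forall y, a < y -> mder h y (h y *m A y).

(** Stability alone gives some X for each y; the pseudo-inverse of the fixed U picks it linearly in
    A(y), hence continuously, as required of a coefficient in [linear_ode_zero]. *)
Let stable_factor (U : 'M[C]_n) : (forall y, a < y -> (U *m (A y)^T <= U)%MS) ->
  exists X : R -> 'M[C]_n, (forall y, a < y -> mcont X y) /\
    forall y, a < y -> U *m (A y)^T = X y *m U.
Proof.
move=> UA; exists (fun y => U *m (A y)^T *m pinvmx U); split => y ay.
  apply: mcvgM; last exact: mcvg_cst.
  apply: mcvgM; first exact: mcvg_cst.
  by apply: mcvg_tr; exact: contA.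
by rewrite mulmxKpV ?UA.
Qed.

Let dhT y : a < y -> mder (fun y => (h y)^T) y ((A y)^T *m (h y)^T).
Proof. by move=> ay; rewrite -trmx_mul; apply: mder_tr; exact: Hh. Qed.

(** The defect Z = U h^T coker(U) satisfies Z' = X Z, because U A^T = X U. *)
Lemma ode_stable (U : 'M[C]_n) : (forall y, a < y -> (U *m (A y)^T <= U)%MS) ->
  forall y, a < y -> (U *m (h y)^T <= U)%MS.
Proof.
move=> /stable_factor[X [cX UX]] y ay; rewrite submxE; apply/eqP.
apply: (@linear_ode_zero R n a X (cst 0) (fun y => U *m (h y)^T *m cokermx U)) => //.
- by move=> t _; exact: mcvg_cst.
- by rewrite h1 trmx1 mulmx1 mulmx_coker.
move=> t at_; apply: mder_eq (mderMr (cokermx U) (mderMl U (dhT at_))) _ _ => //.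
by rewrite mulmx0 addr0 !mulmxA UX.
Qed.

Lemma ode_in_GC : (forall y, a < y -> infinitesimal_GC W Q (A y)) ->
  forall y, a < y -> in_GC W Q (h y).
Proof.
move=> gA y ay; split.
- exact: (linear_ode_unit contA h1 Hh).
- by move=> k; apply: ode_stable => // t at_; have [] := gA t at_.
move=> k x z xk zk; set U := W k.
have [|X [cX UA]] := @stable_factor U; first by move=> t /gA[+ _]; exact.
have skew t : a < t -> X t *m (U *m Q k *m U^T) + U *m Q k *m U^T *m (X t)^T = 0.
  move=> at_; have [_ AQ] := gA t at_.
  have : U *m ((A t)^T *m Q k + Q k *m A t) *m U^T = 0.
    apply: bil_mx_eq0 => u v uU vU; rewrite -(AQ k u v uU vU).
    by rewrite /bil trmx_mul trmxK mulmxDr mulmxDl mxE !mulmxA.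
  rewrite mulmxDr mulmxDl !mulmxA UA // => <-; congr (_ + _).
  by rewrite -!mulmxA -trmx_mul -UA // trmx_mul trmxK.
(* The defect of the Gram matrix of [Q k] on W_k. By [skew] the constant Gram matrix contributes
   nothing, so D' = X D + D X^T. *)
pose D t := U *m (h t)^T *m Q k *m h t *m U^T - U *m Q k *m U^T.
suff D0 : D y = 0.
  have [c ->] := submxP xk; have [d ->] := submxP zk.
  rewrite /bil /app !trmx_mul trmxK -!mulmxA -/U.
  move/eqP: D0; rewrite subr_eq0 => /eqP E.
  have -> : c *m (U *m ((h y)^T *m (Q k *m (h y *m (U^T *m d^T))))) =
    c *m (U *m (h y)^T *m Q k *m h y *m U^T) *m d^T by rewrite !mulmxA.
  by rewrite E !mulmxA.
apply: (@linear_ode_zero R n a X (fun t => (X t)^T) D) => //.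
- by move=> t at_; apply: mcvg_tr; exact: cX.
- by rewrite /D h1 trmx1 !mulmx1 subrr.
move=> t at_.
have d := mderB (mderMr U^T (mderM (mderMr (Q k) (mderMl U (dhT at_))) (Hh at_)))
  (mder_cst (U *m Q k *m U^T) t).
apply: mder_eq d _ _ => //.
rewrite subr0 mulmxDl /D mulmxBr mulmxBl.
rewrite addrACA -opprD skew // subr0; congr (_ + _).
  by rewrite !mulmxA UA // !mulmxA.
by rewrite -!mulmxA -trmx_mul -UA // trmx_mul trmxK !mulmxA.
Qed.

Lemma ode_in_H : (forall y, a < y -> infinitesimal_H W Q (A y)) ->
  forall y, a < y -> in_H W Q (h y).
Proof.
move=> hA.
have gA t : a < t -> infinitesimal_GC W Q (A t) by move=> /hA[].
have gh := ode_in_GC gA.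
have key k y : a < y -> (W k *m (conjm (h y) - h y)^T <= W (k - 2)%R)%MS.
  move=> ay; rewrite submxE; apply/eqP; set c := cokermx _.
  have cW (B : 'M[C]_n) : (B <= W (k - 2)%R)%MS -> B *m c = 0.
    by rewrite submxE => /eqP.
  move: c cW => c cW.
  have [|X [cX UX]] := @stable_factor (W k); first by move=> t /gA[+ _]; exact.
  apply: (@linear_ode_zero R n a X (cst 0) (fun y => W k *m (conjm (h y) - h y)^T *m c)) => //.
  - by move=> t _; exact: mcvg_cst.
  - rewrite h1 (_ : conjm 1%:M = 1%:M) ?subrr ?trmx0 ?mulmx0 ?mul0mx //.
    exact: map_mx1.
  move=> t at_.
  have d := mderMr c (mderMl (W k) (mder_tr (mderB (mder_conjm (Hh at_)) (Hh at_)))).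
  apply: mder_eq d _ _ => //; rewrite mulmx0 addr0.
  have [[AW _] AR] := hA t at_.
  rewrite 2!mulmxA -UX //.
  (* In the derivative of conj h - h the first summand reproduces the defect; the second sends W_k
     into W_{k-2} by conj A - A and stays there because conj h preserves W_{k-2}, so [c] kills
     it. *)
  have -> : conjm (h t *m A t) - h t *m A t =
      (conjm (h t) - h t) *m A t + conjm (h t) *m (conjm (A t) - A t).
    by rewrite conjmM mulmxBl mulmxBr [RHS]addrC addrA subrK.
  rewrite linearD /= mulmxDr mulmxDl !trmx_mul !mulmxA -[RHS]addr0; congr (_ + _).
  apply: cW; apply: submx_trans (submxMr _ (AR k)) _.
  have [_ hW _] := gh t at_.
  by rewrite -(eqmxMr _ (conjW _)) -(conjW (k - 2)) -conjm_tr -conjmM conjm_sub hW.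
move=> y ay.
have R2 k x : (x <= W k)%MS ->
    ((conjm (app (h y) x) - app (h y) (conjm x))%R <= W (k - 2)%R)%MS.
  move=> xk; rewrite /app conjmM conjm_tr -mulmxBr -linearB /=.
  apply: submx_trans (key k y ay); apply: submxMr.
  by rewrite -(conjW k) conjm_sub.
(* Reality modulo W_{k-1}, demanded by G, follows from reality modulo the smaller W_{k-2}. *)
split => //; split; first exact: gh.
move=> k x xk; apply: submx_trans (R2 k x xk) _.
have [Wi _ _] := filtW; have := Wi (k - 2).
by rewrite (_ : k - 2 + 1 = k - 1) // -addrA.
Qed.

End Integration.

(** * Integration of the Lax equation and the motion of F_o *)

Theorem theorem7p1 (R : realType) (n : nat)
    (W : int -> 'M[R[i]]_n) (Q : int -> 'M[R[i]]_n) (d : int -> nat)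
    (Fo : int -> 'M[R[i]]_n) (N : nat) (I : int -> int -> 'M[R[i]]_n)
    (a : R) (beta : R -> 'M[R[i]]_n) :
  rational_increasing_filtration W ->
  graded_forms W Q ->
  in_M W Q d Fo ->
  is_split_Deligne_bigrading Fo W N I ->
  (forall y : R, a < y ->
     [/\ in_lieH W Q (beta y), mx_derivable beta y
       & mx_deriv beta y = - (beta y *m Lop N I (beta y) - Lop N I (beta y) *m beta y)]) ->
  exists (h : R -> 'M[R[i]]_n) (Nt : 'M[R[i]]_n) (Ft : int -> 'M[R[i]]_n),
    [/\ in_lieH W Q Nt,
        in_Mcheck W Q d Ft
      & forall y : R, a < y ->
          [/\ in_H W Q (h y), mx_derivable h y,
              invmx (h y) *m mx_deriv h y = - Lop N I (beta y),
              beta y = invmx (h y) *m Nt *m h y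
            & forall p : int,
                (img (h y) (Fo p) ==
                 img (expm ((y%:C)%C * 'i *: Nt)) (Ft p))%MS]].
Proof.
move=> filtW gfQ MF bigI lax.
have polF k p x y : (x <= Fo p :&: W k)%MS -> (y <= Fo (k - p + 1)%R :&: W k)%MS ->
    bil (Q k) x y = 0.
  by have [[_ H] _] := MF; have [_ _ h _] := H k p; exact: h.
have inf y : a < y -> infinitesimal_H W Q (beta y).
  by move=> /lax[h _ _]; exact: lieH_infinitesimal.
pose A y := - Lop N I (beta y).
have infA y : a < y -> infinitesimal_H W Q (A y).
  move=> ay; apply: infinitesimal_HN.
  exact: (Lop_infinitesimal_H gfQ polF bigI (inf y ay)).
have dbeta y : a < y -> mder beta y (beta y *m A y - A y *m beta y).
  move=> /lax[_ /mx_deriv_mder + E]; rewrite E /A mulmxN mulNmx opprK.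
  by rewrite opprB addrC.
have cA y : a < y -> mcont A y.
  move=> ay; apply: mcvgN; apply: mcvg_sum => ij; apply: mcvg_sum => kl.
  apply: mcvgZ; first exact: ccvg_cst.
  apply: mcvgM; last exact: mcvg_cst.
  apply: mcvgM; first exact: mcvg_cst.
  exact: mder_cont (dbeta y ay).
have [h [h1 Hh]] := linear_ode cA.
pose y0 := a + 1; have ay0 : a < y0 by rewrite ltrDl.
pose Nt := beta y0.
have hU y (ay : a < y) : h y \in unitmx := linear_ode_unit cA h1 Hh ay.
(* Written without the inverse of h, so that the difference of the two sides satisfies Z' = Z A and
   nothing inverse has to be differentiated. *)
have hb y : a < y -> h y *m beta y = Nt *m h y.
  move=> ay; apply/eqP; rewrite -subr_eq0; apply/eqP.
  apply: (@linear_ode_zero R n a (cst 0) A (fun y => h y *m beta y - Nt *m h y)) => //.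
  - by move=> t _; exact: mcvg_cst.
  - by rewrite h1 mulmx1 mul1mx subrr.
  move=> t at_.
  apply: mder_eq (mderB (mderM (Hh t at_) (dbeta t at_)) (mderMl Nt (Hh t at_))) _ _ => //.
  by rewrite mul0mx add0r mulmxBr mulmxBl !mulmxA [_ + (_ - _)]addrC subrK.
pose E s := expm (s%:C%C *: ('i *: Nt)).
have E0 : E 0 = 1%:M by exact: expm0.
have ED s t : E (s + t) = E t *m E s by exact: expmD.
have dE s : mder E s (E s *m ('i *: Nt)) by exact: expm_der.
have EE s : expm (s%:C%C * 'i *: Nt) = E s by rewrite /E scalerA.
have gN : infinitesimal_GC W Q ((- y0)%:C%C *: ('i *: Nt)).
  by apply: infinitesimal_GCZ; apply: infinitesimal_GCZ; case: (inf y0 ay0).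
(* The exponential of X is a solution with constant coefficient X on ]-1, oo[, whose base point -1 +
   1 is 0; its value at 1 is the matrix wanted. *)
have EGC : in_GC W Q (E (- y0)).
  pose X := (- y0)%:C%C *: ('i *: Nt).
  have -> : E (- y0) = expm (1%:C%C *: X) by rewrite scale1r.
  have F0 : expm ((-1 + 1)%:C%C *: X) = 1%:M by rewrite addNr expm0.
  have lt : -1 < 1 :> R by lra.
  exact: (@ode_in_GC R n W Q (-1) (cst X) (fun t => expm (t%:C%C *: X))
    (fun t _ => mcvg_cst X) F0 (fun t _ => expm_der X t) (fun t _ => gN) 1 lt).
move: E E0 ED dE EE EGC => E E0 ED dE EE EGC.
have EU s : E s \in unitmx.
  have : E s *m E (- s) = 1%:M by rewrite -ED addNr E0.
  by case/mulmx1_unit.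
pose k y := E (y0 - y) *m h y.
have k1 : k y0 = 1%:M by rewrite /k subrr E0 h1 mulmx1.
pose B y := - ('i *: beta y + Lop N I (beta y)).
have cB y : a < y -> mcont B y.
  move=> ay; rewrite (_ : B = fun y => - 'i *: beta y + A y); last first.
    by apply/funext => t; rewrite /B /A opprD scaleNr.
  apply: mcvgD; last exact: cA.
  by apply: mcvgZ; [exact: ccvg_cst|exact: mder_cont (dbeta y ay)].
have dk y : a < y -> mder k y (k y *m B y).
  move=> ay.
  have ds : is_derive y 1 (fun y => y0 - y) (- 1 : R).
    have -> : (fun y => y0 - y) = cst y0 - id by [].
    by apply: is_derive_eq; rewrite sub0r.
  have D := @mder_comp R n n E (fun y => y0 - y) y (-1) _ (dE (y0 - y)) ds.
  apply: mder_eq (mderM D (Hh y ay)) _ _ => //.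
  (* By [hb], iN h = h (i beta), which moves the coefficient of the exponential to the right of
     k. *)
  rewrite /k /B opprD mulmxDr rmorphN1 scaleN1r !mulmxA; congr (_ + _).
  by rewrite mulNmx mulmxN -!scalemxAr -!scalemxAl -!mulmxA hb.
have kF y p : a < y -> (Fo p *m (k y)^T == Fo p)%MS.
  move=> ay.
  have sub : (Fo p *m (k y)^T <= Fo p)%MS.
    (* Stability gives only an inclusion; invertibility of k(y) upgrades it to equality by comparing
       ranks. *)
    apply: (ode_stable cB k1 dk _ ay) => t at_.
    by rewrite /B linearN /= mulmxN eqmx_opp; exact: Lop_plus_i_F bigI _ _.
  rewrite -(mxrank_leqif_eq sub) mxrankMfree // row_free_unit unitmx_tr.
  by rewrite unitmx_mul EU hU.
exists h, Nt, (fun p => img (E (- y0)) (Fo p)); split.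
- by have [] := lax y0 ay0.
- by exists (E (- y0)), Fo; split => // p; exact/eqmxP.
move=> y ay; have [dh1 dh2] := mder_mx_deriv (Hh y ay); split => //.
- exact: (ode_in_H filtW cA h1 Hh infA ay).
- by rewrite dh2 mulKmx ?hU.
- by rewrite -mulmxA -hb // mulKmx ?hU.
move=> p; rewrite EE /img -mulmxA -trmx_mul -ED.
have -> : h y = E (- y0 + y) *m k y.
  by rewrite /k mulmxA -ED addrACA subrr addNr addr0 E0 mul1mx.
by rewrite trmx_mul mulmxA; apply/eqmxP/eqmxMr/eqmxP; exact: kF.
Qed.
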